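(* Let $0<\lambda\le1$, $f\in\mathcal U(\lambda)$ and $a_2=f''(0)/2$. Then $$\frac{z}{f(z)}+a_2z\prec 1+2\lambda z+\lambda z^2,\qquad z\in\mathbb D.$$
   Context: $\mathbb D=\{z\in\mathbb C:|z|<1\}$. $\mathcal A$ is the class of functions $f$ analytic in $\mathbb D$ with $f(z)=z+\sum_{k\ge2}a_kz^k$. For $f\in\mathcal A$ with $f(z)\ne0$ for $z\in\mathbb D\setminus\{0\}$, set $U_f(z)=\left(\frac{z}{f(z)}\right)^2f'(z)-1$. For $0<\lambda\le1$, $\mathcal U(\lambda)$ is the class of such $f\in\mathcal A$ with $|U_f(z)|<\lambda$ for all $z\in\mathbb D$. For $g,h$ analytic in $\mathbb D$, $g\prec h$ (subordination) means $g=h\circ\omega$ for some analytic $\omega:\mathbb D\to\mathbb D$ with $\omega(0)=0$. *)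

(* Defs.v *)
From Stdlib Require Import Reals.
From Coquelicot Require Import Coquelicot.
Open Scope C_scope.

Definition inD (z : C) : Prop := (Cmod z < 1)%R.

Definition cderiv (f : C -> C) (z l : C) : Prop :=
  @is_derive C_AbsRing C_NormedModule f z l.

Definition analytic_D (f : C -> C) : Prop :=
  forall z, inD z -> exists l, cderiv f z l.

Definition subordinate (g h : C -> C) : Prop :=
  exists w : C -> C,
    analytic_D w /\ w 0 = 0 /\ (forall z, inD z -> inD (w z)) /\
    (forall z, inD z -> g z = h (w z)).

(* z / f(z) on D, with its removable singularity at 0 filled in
   (value 1, since f(0)=0, f'(0)=1). *)
Definition z_over_f (f : C -> C) (z : C) : C :=
  if Ceq_dec z 0 then 1 else z / f z.

(* Main.v *)
Require Import Defs.
From Stdlib Require Import Reals Lra Psatz ClassicalEpsilon.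
From Coquelicot Require Import Coquelicot.
Open Scope R_scope.

(* Put g(z) = z/f(z) + a2 z - 1, so that g(0) = g'(0) = 0 and U_f(z) = g(z) - z g'(z).
   If z0 maximizes |g| on the circle |z| = rho, the maximum principle for g(z)/z^2 gives
   |g(s z0)| <= s^2 |g(z0)| for 0 < s < 1; letting s tend to 1 in
   g(s z0) = s g(z0) + (1 - s) (g(z0) - z0 g'(z0)) + o(1 - s)
   yields |g(z0)| <= |g(z0) - z0 g'(z0)| < lam.  Hence |g| < lam on D and
   w = sqrt(1 + g/lam) - 1 is the required function: |w| |w + 2| = |g/lam| < 1, while
   |w + 2| > 1 because the root has positive real part.
   The maximum principle near the singularity 0 comes from Goursat's theorem on rectangles
   in the logarithmic coordinate. *)

(** * Complex differentiability *)

(** The square root comes from completing the square: the majorant is [1 - lam + lam (1 + w)^2], so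
    equating it with [1 + g] means [(1 + w)^2 = 1 + g/lam]. In [g - z g'] the terms [a2 z] cancel,
    so the formula for U_f would hold with any coefficient; the value f''(0)/2 is what makes g'(0) =
    0. The obstacle is that analyticity is given as mere complex differentiability, and g'(0) = 0
    then says only g(z) = o(z): the quotient F = g/z^2 is not known to be bounded near 0, only z
    F(z) -> 0. The integrals are shaped around this. Under z = exp(zeta) circles about 0 become
    vertical segments, the horizontal sides of a rectangle of height 2 PI cancel by periodicity, and
    the measure dz/z lets z F(z) -> 0 remove the contribution of small circles. *)

Definition ccont (f : C -> C) (z : C) : Prop :=
  forall eps, 0 < eps -> exists d, 0 < d /\
    forall w, Cmod (w - z) < d -> Cmod (f w - f z) < eps.

(* Caratheodory's form of complex differentiability: the chain, product and
   quotient rules become identities between continuous slope functions. *)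
Definition cdiff (f : C -> C) (z l : C) : Prop :=
  exists phi, phi z = l /\ ccont phi z /\ exists d, 0 < d /\
    forall w, Cmod (w - z) < d -> (f w = f z + phi w * (w - z))%C.

Lemma Cmod_triangle_rev (x y : C) : Cmod x - Cmod y <= Cmod (x - y).
Proof.
  pose proof (Cmod_triangle (x - y) y) as H.
  replace (x - y + y)%C with x in H by ring. lra.
Qed.

Lemma Cmod_minus_sym (x y : C) : Cmod (x - y) = Cmod (y - x).
Proof. rewrite <- Cmod_opp. f_equal. ring. Qed.

Lemma Cmod_minus_diag (x : C) : Cmod (x - x) = 0.
Proof. replace (x - x)%C with (RtoC 0) by ring. apply Cmod_0. Qed.

Lemma ccont_local (f g : C -> C) (z : C) (d : R) :
  0 < d -> (forall w, Cmod (w - z) < d -> f w = g w) -> ccont f z -> ccont g z.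
Proof.
  intros Hd Hfg Hf eps He. destruct (Hf eps He) as (d' & Hd' & H).
  exists (Rmin d d'). split. { apply Rmin_glb_lt; assumption. }
  intros w Hw.
  assert (Cmod (w - z) < d /\ Cmod (w - z) < d') as [H1 H2].
  { split; eapply Rlt_le_trans; try exact Hw; [apply Rmin_l | apply Rmin_r]. }
  rewrite <- (Hfg w H1), <- (Hfg z). 2: rewrite Cmod_minus_diag; exact Hd.
  auto.
Qed.

Lemma ccont_const (c z : C) : ccont (fun _ => c) z.
Proof.
  intros eps He. exists 1. split. lra. intros w _. rewrite Cmod_minus_diag. exact He.
Qed.

Lemma ccont_id (z : C) : ccont (fun w => w) z.
Proof. intros eps He. exists eps. auto. Qed.

Lemma ccont_plus (f g : C -> C) (z : C) :
  ccont f z -> ccont g z -> ccont (fun w => f w + g w)%C z.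
Proof.
  intros Hf Hg eps He.
  destruct (Hf (eps / 2) ltac:(lra)) as (d1 & Hd1 & H1).
  destruct (Hg (eps / 2) ltac:(lra)) as (d2 & Hd2 & H2).
  exists (Rmin d1 d2). split. { apply Rmin_glb_lt; assumption. }
  intros w Hw.
  specialize (H1 w (Rlt_le_trans _ _ _ Hw (Rmin_l _ _))).
  specialize (H2 w (Rlt_le_trans _ _ _ Hw (Rmin_r _ _))).
  replace (f w + g w - (f z + g z))%C with ((f w - f z) + (g w - g z))%C by ring.
  eapply Rle_lt_trans. apply Cmod_triangle. lra.
Qed.

Lemma ccont_mult (f g : C -> C) (z : C) :
  ccont f z -> ccont g z -> ccont (fun w => f w * g w)%C z.
Proof.
  intros Hf Hg eps He.
  set (A := Cmod (f z) + 1). set (B := Cmod (g z) + 1).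
  assert (HA : 0 < A) by (unfold A; pose proof (Cmod_ge_0 (f z)); lra).
  assert (HB : 0 < B) by (unfold B; pose proof (Cmod_ge_0 (g z)); lra).
  destruct (Hf (eps / (2 * B))) as (d1 & Hd1 & H1). { apply Rdiv_lt_0_compat; lra. }
  destruct (Hg (Rmin 1 (eps / (2 * A)))) as (d2 & Hd2 & H2).
  { apply Rmin_glb_lt. lra. apply Rdiv_lt_0_compat; lra. }
  exists (Rmin d1 d2). split. { apply Rmin_glb_lt; assumption. }
  intros w Hw.
  specialize (H1 w (Rlt_le_trans _ _ _ Hw (Rmin_l _ _))).
  specialize (H2 w (Rlt_le_trans _ _ _ Hw (Rmin_r _ _))).
  assert (H3 := Rlt_le_trans _ _ _ H2 (Rmin_l _ _)).
  assert (H4 := Rlt_le_trans _ _ _ H2 (Rmin_r _ _)).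
  pose proof (Cmod_triangle_rev (g w) (g z)) as H5.
  replace (f w * g w - f z * g z)%C with ((f w - f z) * g w + f z * (g w - g z))%C by ring.
  eapply Rle_lt_trans. apply Cmod_triangle. rewrite 2!Cmod_mult.
  assert (Cmod (f w - f z) * Cmod (g w) <= eps / (2 * B) * B).
  { apply Rmult_le_compat; try apply Cmod_ge_0. lra. unfold B. lra. }
  assert (Cmod (f z) * Cmod (g w - g z) <= Cmod (f z) * (eps / (2 * A))).
  { apply Rmult_le_compat_l. apply Cmod_ge_0. lra. }
  assert (Cmod (f z) * (eps / (2 * A)) < A * (eps / (2 * A))).
  { apply Rmult_lt_compat_r. apply Rdiv_lt_0_compat; lra. unfold A; lra. }
  replace (eps / (2 * B) * B) with (eps / 2) in * by (field; lra).
  replace (A * (eps / (2 * A))) with (eps / 2) in * by (field; lra).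
  lra.
Qed.

Lemma ccont_inv (f : C -> C) (z : C) :
  f z <> 0%C -> ccont f z -> ccont (fun w => / f w)%C z.
Proof.
  intros Hz Hf eps He.
  assert (HA : 0 < Cmod (f z)) by (apply Cmod_gt_0; exact Hz).
  set (A := Cmod (f z)) in *.
  destruct (Hf (Rmin (A / 2) (eps * (A * A / 2)))) as (d & Hd & H).
  { apply Rmin_glb_lt. lra. apply Rmult_lt_0_compat. lra. nra. }
  exists d. split. exact Hd. intros w Hw. specialize (H w Hw).
  assert (H1 := Rlt_le_trans _ _ _ H (Rmin_l _ _)).
  assert (H2 := Rlt_le_trans _ _ _ H (Rmin_r _ _)).
  pose proof (Cmod_triangle_rev (f z) (f w)) as H3. rewrite Cmod_minus_sym in H3. fold A in H3.
  assert (Hw0 : f w <> 0%C) by (apply Cmod_gt_0; lra).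
  replace (/ f w - / f z)%C with (- ((f w - f z) / (f w * f z)))%C
    by (field; split; assumption).
  rewrite Cmod_opp, Cmod_div, Cmod_mult. 2: apply Cmult_neq_0; assumption.
  fold A. set (B := Cmod (f w)) in *.
  apply Rlt_div_l. nra.
  eapply Rlt_le_trans. exact H2. apply Rmult_le_compat_l. lra. nra.
Qed.

Lemma ccont_comp (f g : C -> C) (z : C) :
  ccont g z -> ccont f (g z) -> ccont (fun w => f (g w)) z.
Proof.
  intros Hg Hf eps He. destruct (Hf eps He) as (d & Hd & H).
  destruct (Hg d Hd) as (d' & Hd' & H'). exists d'. split. exact Hd'. auto.
Qed.

Lemma cdiff_ccont (f : C -> C) (z l : C) : cdiff f z l -> ccont f z.
Proof.
  intros (phi & _ & Hp & d & Hd & H).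
  apply ccont_local with (f := fun w => (f z + phi w * (w - z))%C) (d := d).
  exact Hd. intros w Hw. symmetry. auto.
  apply ccont_plus. apply ccont_const. apply ccont_mult. exact Hp.
  apply ccont_plus. apply ccont_id. apply ccont_const.
Qed.

Lemma cdiff_local (f g : C -> C) (z l : C) (d : R) :
  0 < d -> (forall w, Cmod (w - z) < d -> f w = g w) -> cdiff f z l -> cdiff g z l.
Proof.
  intros Hd Hfg (phi & Hl & Hp & d' & Hd' & H). exists phi. repeat split; auto.
  exists (Rmin d d'). split. { apply Rmin_glb_lt; assumption. }
  intros w Hw.
  rewrite <- (Hfg w (Rlt_le_trans _ _ _ Hw (Rmin_l _ _))), <- (Hfg z).
  apply H. exact (Rlt_le_trans _ _ _ Hw (Rmin_r _ _)).
  rewrite Cmod_minus_diag. exact Hd.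
Qed.

Lemma cdiff_const (c z : C) : cdiff (fun _ => c) z 0.
Proof.
  exists (fun _ => RtoC 0). repeat split. apply ccont_const. exists 1. split. lra. intros. ring.
Qed.

Lemma cdiff_id (z : C) : cdiff (fun w => w) z 1.
Proof.
  exists (fun _ => RtoC 1). repeat split. apply ccont_const. exists 1. split. lra. intros. ring.
Qed.

Lemma cdiff_plus (f g : C -> C) (z l m : C) :
  cdiff f z l -> cdiff g z m -> cdiff (fun w => f w + g w)%C z (l + m).
Proof.
  intros (phi & Hl & Hp & d & Hd & H) (psi & Hm & Hq & d' & Hd' & H').
  exists (fun w => phi w + psi w)%C. split. congruence. split. apply ccont_plus; assumption.
  exists (Rmin d d'). split. { apply Rmin_glb_lt; assumption. }
  intros w Hw. rewrite (H w), (H' w). ring.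
  exact (Rlt_le_trans _ _ _ Hw (Rmin_r _ _)). exact (Rlt_le_trans _ _ _ Hw (Rmin_l _ _)).
Qed.

Lemma cdiff_mult (f g : C -> C) (z l m : C) :
  cdiff f z l -> cdiff g z m -> cdiff (fun w => f w * g w)%C z (l * g z + f z * m).
Proof.
  intros Hf Hg. pose proof (cdiff_ccont _ _ _ Hg) as Hc. revert Hf Hg.
  intros (phi & Hl & Hp & d & Hd & H) (psi & Hm & Hq & d' & Hd' & H').
  exists (fun w => phi w * g w + f z * psi w)%C. split. congruence.
  split. { apply ccont_plus; apply ccont_mult; auto. apply ccont_const. }
  exists (Rmin d d'). split. { apply Rmin_glb_lt; assumption. }
  intros w Hw. rewrite (H w), (H' w). ring.
  exact (Rlt_le_trans _ _ _ Hw (Rmin_r _ _)). exact (Rlt_le_trans _ _ _ Hw (Rmin_l _ _)).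
Qed.

Lemma cdiff_comp (f g : C -> C) (z l m : C) :
  cdiff f (g z) l -> cdiff g z m -> cdiff (fun w => f (g w)) z (l * m).
Proof.
  intros Hf Hg. pose proof (cdiff_ccont _ _ _ Hg) as Hc. revert Hf Hg.
  intros (phi & Hl & Hp & d & Hd & H) (psi & Hm & Hq & d' & Hd' & H').
  exists (fun w => phi (g w) * psi w)%C. split. congruence.
  split. { apply ccont_mult. apply ccont_comp; assumption. assumption. }
  destruct (Hc d Hd) as (d2 & Hd2 & H2).
  exists (Rmin d2 d'). split. { apply Rmin_glb_lt; assumption. }
  intros w Hw. rewrite (H (g w)).
  - rewrite (H' w) at 2. ring. exact (Rlt_le_trans _ _ _ Hw (Rmin_r _ _)).
  - apply H2. exact (Rlt_le_trans _ _ _ Hw (Rmin_l _ _)).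
Qed.

Lemma ccont_neq_0 (f : C -> C) (z : C) :
  f z <> 0%C -> ccont f z ->
  exists d, 0 < d /\ forall w, Cmod (w - z) < d -> f w <> 0%C.
Proof.
  intros Hz Hf. destruct (Hf (Cmod (f z))) as (d & Hd & H). { apply Cmod_gt_0. exact Hz. }
  exists d. split. exact Hd. intros w Hw E. specialize (H w Hw). rewrite E, Cmod_minus_sym in H.
  replace (f z - 0)%C with (f z) in H by ring. lra.
Qed.

Lemma cdiff_inv (f : C -> C) (z l : C) :
  f z <> 0%C -> cdiff f z l -> cdiff (fun w => / f w)%C z (- l / (f z * f z)).
Proof.
  intros Hz Hf. pose proof (cdiff_ccont _ _ _ Hf) as Hc.
  destruct (ccont_neq_0 f z Hz Hc) as (d' & Hd' & Hn).
  destruct Hf as (phi & Hl & Hp & d & Hd & H).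
  exists (fun w => (- (1)) * phi w * / (f w * f z))%C.
  split. { rewrite Hl. field. assumption. }
  split. { apply ccont_mult. apply ccont_mult. apply ccont_const. exact Hp.
    apply (ccont_inv (fun w => f w * f z)%C). apply Cmult_neq_0; assumption.
    apply ccont_mult. assumption. apply ccont_const. }
  exists (Rmin d d'). split. { apply Rmin_glb_lt; assumption. }
  intros w Hw.
  assert (H1 := H w (Rlt_le_trans _ _ _ Hw (Rmin_l _ _))).
  assert (H2 := Hn w (Rlt_le_trans _ _ _ Hw (Rmin_r _ _))).
  replace (/ f z + - (1) * phi w * / (f w * f z) * (w - z))%C
    with ((f w - phi w * (w - z)) / (f w * f z))%C by (field; auto).
  rewrite H1 at 2. field. auto.
Qed.

Lemma cdiff_pow (f : C -> C) (z l : C) (n : nat) :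
  cdiff f z l -> exists m, cdiff (fun w => f w ^ n)%C z m.
Proof.
  intros Hf. induction n as [|n [m IH]].
  - exists 0%C. exact (cdiff_const 1 z).
  - eexists. exact (cdiff_mult f (fun w => (f w ^ n)%C) z l m Hf IH).
Qed.

Lemma cderiv_eps (f : C -> C) (z l : C) :
  cderiv f z l <-> forall eps, 0 < eps -> exists d, 0 < d /\
    forall w, Cmod (w - z) < d -> Cmod (f w - f z - l * (w - z)) <= eps * Cmod (w - z).
Proof.
  split.
  - intros [_ H] eps He.
    destruct (H z (fun P HP => HP) (mkposreal eps He)) as [d Hd].
    exists d. split. apply cond_pos. intros w Hw.
    rewrite (Cmult_comm l). exact (Hd w Hw).
  - intros H. split.
    + apply is_linear_scal_l.
    (* [is_derive] quantifies over every limit [x] of the neighbourhood filter of [z]; uniqueness of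
       limits leaves only [z]. *)
    + intros x Hx eps. assert (x = z) as ->.
      { apply eq_sym, (is_filter_lim_locally_unique (K := C_AbsRing) (V := AbsRing_NormedModule C_AbsRing)).
        exact Hx. }
      destruct (H eps (cond_pos eps)) as (d & Hd & H'). exists (mkposreal d Hd).
      intros w Hw. specialize (H' w Hw). rewrite (Cmult_comm l) in H'. exact H'.
Qed.

(** The slope function is the difference quotient completed by [l] at [z]; its continuity at [z] is
    the first-order estimate divided by [|w - z|]. Taking [eps / 2] there turns the weak inequality
    into a strict one. *)
Lemma cderiv_cdiff (f : C -> C) (z l : C) : cderiv f z l <-> cdiff f z l.
Proof.
  rewrite cderiv_eps. split.
  - intros H.
    exists (fun w => if Ceq_dec w z then l else (f w - f z) / (w - z))%C.
    split. { destruct (Ceq_dec z z); congruence. }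
    split.
    + intros eps He. destruct (H (eps / 2) ltac:(lra)) as (d & Hd & H').
      exists d. split. exact Hd. intros w Hw. destruct (Ceq_dec z z) as [_|]; [|congruence].
      destruct (Ceq_dec w z) as [E|E]. { rewrite Cmod_minus_diag. exact He. }
      assert (Hn : (w - z)%C <> 0%C). { intros E'. apply E. replace w with (w - z + z)%C by ring. rewrite E'. ring. }
      replace ((f w - f z) / (w - z) - l)%C with ((f w - f z - l * (w - z)) / (w - z))%C by (field; exact Hn).
      rewrite Cmod_div by exact Hn. pose proof (proj1 (Cmod_gt_0 _) Hn).
      apply Rlt_div_l. assumption. specialize (H' w Hw). nra.
    + exists 1. split. lra. intros w _. destruct (Ceq_dec w z) as [->|E]. ring. field.
      intros E'. apply E. replace w with (w - z + z)%C by ring. rewrite E'. ring.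
  - intros (phi & Hl & Hp & d & Hd & H) eps He. destruct (Hp eps He) as (d' & Hd' & H').
    exists (Rmin d d'). split. { apply Rmin_glb_lt; assumption. }
    intros w Hw. rewrite (H w) by exact (Rlt_le_trans _ _ _ Hw (Rmin_l _ _)).
    replace (f z + phi w * (w - z) - f z - l * (w - z))%C with ((phi w - phi z) * (w - z))%C
      by (rewrite Hl; ring).
    rewrite Cmod_mult. apply Rmult_le_compat_r. apply Cmod_ge_0. left.
    apply H'. exact (Rlt_le_trans _ _ _ Hw (Rmin_r _ _)).
Qed.

Lemma cdiff_eq (f : C -> C) (z l m : C) : cdiff f z l -> l = m -> cdiff f z m.
Proof. intros H <-. exact H. Qed.

Lemma cdiff_scal (f : C -> C) (c z l : C) : cdiff f z l -> cdiff (fun w => c * f w)%C z (c * l).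
Proof.
  intros Hf. eapply cdiff_eq. exact (cdiff_mult _ _ _ _ _ (cdiff_const c z) Hf). cbv beta. ring.
Qed.

Lemma cdiff_shift (z0 z : C) : cdiff (fun w => w - z0)%C z 1.
Proof.
  eapply cdiff_eq. exact (cdiff_plus _ _ _ _ _ (cdiff_id z) (cdiff_const (- z0) z)). ring.
Qed.

(** * Integrals of complex-valued functions *)

Definition CInt (f : R -> C) (a b : R) : C := RInt (V := C_R_CompleteNormedModule) f a b.

Definition rcont (f : R -> C) (t : R) : Prop :=
  continuous (T := R_UniformSpace) (U := C_R_CompleteNormedModule) f t.

Lemma rcont_eps (f : R -> C) (t : R) :
  rcont f t <-> forall eps, 0 < eps -> exists d, 0 < d /\
     forall s, Rabs (s - t) < d -> Cmod (f s - f t) < eps.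
Proof.
  assert (H2 : 0 < sqrt 2) by (apply sqrt_lt_R0; lra).
  split; intros H.
  - intros eps He.
    (* Balls of the product structure on C compare components separately, so passing to [Cmod] costs
       a factor [sqrt 2]. *)
    assert (He' : 0 < eps / sqrt 2) by (apply Rdiv_lt_0_compat; assumption).
    destruct (proj1 (filterlim_locally (U := C_R_CompleteNormedModule) _ _) H (mkposreal _ He')) as [d Hd].
    exists d. split. apply cond_pos. intros s Hs. specialize (Hd s Hs).
    apply C_NormedModule_mixin_compat2 in Hd. simpl in Hd.
    replace (sqrt 2 * (eps / sqrt 2)) with eps in Hd by (field; lra). exact Hd.
  - apply (filterlim_locally (U := C_R_CompleteNormedModule)). intros eps.
    destruct (H eps (cond_pos eps)) as (d & Hd & H'). exists (mkposreal d Hd).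
    intros s Hs. apply C_NormedModule_mixin_compat1. apply H'. exact Hs.
Qed.

Lemma ccont_rcont_h (K : C -> C) (x y : R) :
  ccont K (x, y) -> rcont (fun t => K (t, y)) x.
Proof.
  intros H. apply rcont_eps. intros eps He. destruct (H eps He) as (d & Hd & H').
  exists d. split. exact Hd. intros s Hs. apply H'.
  replace ((s, y) - (x, y))%C with (RtoC (s - x)).
  - rewrite Cmod_R. exact Hs.
  - apply injective_projections; simpl; ring.
Qed.

Lemma ccont_rcont_v (K : C -> C) (x y : R) :
  ccont K (x, y) -> rcont (fun t => K (x, t)) y.
Proof.
  intros H. apply rcont_eps. intros eps He. destruct (H eps He) as (d & Hd & H').
  exists d. split. exact Hd. intros s Hs. apply H'.
  replace ((x, s) - (x, y))%C with (RtoC (s - y) * Ci)%C.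
  - rewrite Cmod_mult, Cmod_R, Cmod_Ci. lra.
  - apply injective_projections; simpl; ring.
Qed.

Lemma ex_CInt (f : R -> C) (a b : R) :
  a <= b -> (forall t, a <= t <= b -> rcont f t) ->
  ex_RInt (V := C_R_CompleteNormedModule) f a b.
Proof.
  intros Hab H. apply (ex_RInt_continuous (V := C_R_CompleteNormedModule)).
  rewrite Rmin_left, Rmax_right by assumption. exact H.
Qed.

Lemma is_CInt (f : R -> C) (a b : R) :
  a <= b -> (forall t, a <= t <= b -> rcont f t) ->
  is_RInt (V := C_R_NormedModule) f a b (CInt f a b).
Proof. intros Hab H. apply (RInt_correct (V := C_R_CompleteNormedModule)). apply ex_CInt; assumption. Qed.

Lemma CInt_ext (f g : R -> C) (a b : R) :
  a <= b -> (forall t, a <= t <= b -> f t = g t) -> CInt f a b = CInt g a b.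
Proof.
  intros Hab H. apply (RInt_ext (V := C_R_CompleteNormedModule)). rewrite Rmin_left, Rmax_right by assumption.
  intros x Hx. apply H. lra.
Qed.

Lemma CInt_plus (f g : R -> C) (a b : R) :
  a <= b -> (forall t, a <= t <= b -> rcont f t) -> (forall t, a <= t <= b -> rcont g t) ->
  CInt (fun t => f t + g t)%C a b = (CInt f a b + CInt g a b)%C.
Proof.
  intros Hab Hf Hg. apply (RInt_plus (V := C_R_CompleteNormedModule)); apply ex_CInt; assumption.
Qed.

(** The integral is linear over R; for a complex factor the real and imaginary parts are integrated
    separately and recombined by the multiplication rule. *)
Lemma CInt_scal (f : R -> C) (c : C) (a b : R) :
  a <= b -> (forall t, a <= t <= b -> rcont f t) ->
  CInt (fun t => c * f t)%C a b = (c * CInt f a b)%C.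
Proof.
  intros Hab Hf. pose proof (is_CInt f a b Hab Hf) as H.
  apply (is_RInt_unique (V := C_R_CompleteNormedModule)).
  pose proof (is_RInt_fct_extend_fst (U := R_NormedModule) (V := R_NormedModule) _ _ _ _ H) as H1.
  pose proof (is_RInt_fct_extend_snd (U := R_NormedModule) (V := R_NormedModule) _ _ _ _ H) as H2.
  apply (is_RInt_fct_extend_pair (U := R_NormedModule) (V := R_NormedModule)).
  - apply (is_RInt_minus (V := R_NormedModule)); apply (is_RInt_scal (V := R_NormedModule)); assumption.
  - apply (is_RInt_plus (V := R_NormedModule)); apply (is_RInt_scal (V := R_NormedModule)); assumption.
Qed.

Lemma CInt_Chasles (f : R -> C) (a b c : R) :
  a <= b -> b <= c -> (forall t, a <= t <= c -> rcont f t) ->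
  CInt f a c = (CInt f a b + CInt f b c)%C.
Proof.
  intros Hab Hbc H. symmetry. apply (RInt_Chasles (V := C_R_CompleteNormedModule));
  apply ex_CInt; trivial; intros; apply H; lra.
Qed.

Lemma CInt_bound (f : R -> C) (a b M : R) :
  a <= b -> (forall t, a <= t <= b -> rcont f t) ->
  (forall t, a <= t <= b -> Cmod (f t) <= M) -> Cmod (CInt f a b) <= (b - a) * M.
Proof.
  intros Hab Hf HM. rewrite Cmod_norm.
  apply (norm_RInt_le_const (V := C_R_NormedModule) f a b).
  exact Hab. intros x Hx. specialize (HM x Hx). rewrite Cmod_norm in HM. exact HM.
  apply is_CInt; assumption.
Qed.

Lemma CInt_Re_ge (f : R -> C) (a b m : R) :
  a <= b -> (forall t, a <= t <= b -> rcont f t) ->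
  (forall t, a <= t <= b -> m <= Re (f t)) -> (b - a) * m <= Re (CInt f a b).
Proof.
  intros Hab Hf Hm. pose proof (is_CInt f a b Hab Hf) as H.
  pose proof (is_RInt_fct_extend_fst (U := R_NormedModule) (V := R_NormedModule) _ _ _ _ H) as H1.
  apply (is_RInt_le (fun _ => m) (fun t => Re (f t)) a b). exact Hab.
  apply (is_RInt_const (V := R_NormedModule)). exact H1. intros t Ht. apply Hm. lra.
Qed.

(** The path [t -> p + t e] has an arbitrary direction so that [e = 1] and [e = Ci] serve the
    horizontal and the vertical sides of a rectangle. *)
Lemma CInt_primitive (F K : C -> C) (p e : C) (a b : R) :
  a <= b ->
  (forall t : R, a <= t <= b -> cdiff F (p + t * e) (K (p + t * e))%C) ->
  (forall t : R, a <= t <= b -> rcont (fun t => K (p + t * e)%C) t) ->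
  (e * CInt (fun t => K (p + t * e)%C) a b = F (p + b * e) - F (p + a * e))%C.
Proof.
  intros Hab HF HK. rewrite <- CInt_scal by assumption.
  apply (is_RInt_unique (V := C_R_CompleteNormedModule)).
  apply (is_RInt_derive (V := C_R_CompleteNormedModule) (fun t : R => F (p + t * e)%C)).
  - rewrite Rmin_left, Rmax_right by assumption. intros t Ht.
    pose proof (proj1 (cderiv_eps _ _ _) (proj2 (cderiv_cdiff _ _ _) (HF t Ht))) as HD.
    split. apply is_linear_scal_l.
    intros x Hx eps. assert (x = t) as ->.
    { apply eq_sym, (is_filter_lim_locally_unique (K := R_AbsRing) (V := R_NormedModule)). exact Hx. }
    set (A := Cmod e + 1). assert (HA : 0 < A) by (unfold A; pose proof (Cmod_ge_0 e); lra).
    destruct (HD (eps / A)) as (d & Hd & H').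
    { apply Rdiv_lt_0_compat. apply cond_pos. exact HA. }
    assert (Hd' : 0 < d / A) by (apply Rdiv_lt_0_compat; assumption).
    exists (mkposreal _ Hd'). intros s Hs.
    change (Rabs (s - t) < d / A) in Hs.
    assert (Hst : (p + s * e - (p + t * e) = RtoC (s - t) * e)%C) by (rewrite RtoC_minus; ring).
    assert (Hm : Cmod (p + s * e - (p + t * e)) <= Rabs (s - t) * A).
    { rewrite Hst, Cmod_mult, Cmod_R. apply Rmult_le_compat_l. apply Rabs_pos. unfold A; lra. }
    assert (Hlt : Cmod (p + s * e - (p + t * e)) < d).
    { eapply Rle_lt_trans. exact Hm. apply Rlt_div_r in Hs. exact Hs. exact HA. }
    specialize (H' _ Hlt).
    match goal with |- ?L <= _ =>
      replace L with (Cmod (F (p + s * e) - F (p + t * e) - K (p + t * e) * (p + s * e - (p + t * e)))%C) end.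
    + eapply Rle_trans. exact H'.
      change (eps / A * Cmod (p + s * e - (p + t * e)) <= eps * Rabs (s - t)).
      replace (eps * Rabs (s - t)) with (eps / A * (Rabs (s - t) * A)) by (field; lra).
      apply Rmult_le_compat_l. apply Rlt_le, Rdiv_lt_0_compat. apply cond_pos. exact HA. exact Hm.
    + rewrite Hst.
      replace (F (p + s * e) - F (p + t * e) - K (p + t * e) * (RtoC (s - t) * e))%C
        with (F (p + s * e) - F (p + t * e) - RtoC (s - t) * (e * K (p + t * e)))%C by ring.
      rewrite Cmod_norm, <- (scal_R_Cmult (s - t)). reflexivity.
  - rewrite Rmin_left, Rmax_right by assumption. intros t Ht.
    apply rcont_eps. intros eps He.
    assert (HA : 0 < Cmod e + 1) by (pose proof (Cmod_ge_0 e); lra).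
    destruct (proj1 (rcont_eps _ _) (HK t Ht) (eps / (Cmod e + 1))) as (d & Hd & H').
    { apply Rdiv_lt_0_compat; assumption. }
    exists d. split. exact Hd. intros s Hs. specialize (H' s Hs).
    replace (e * K (p + s * e) - e * K (p + t * e))%C with (e * (K (p + s * e) - K (p + t * e)))%C by ring.
    rewrite Cmod_mult. apply Rlt_div_r in H'. 2: exact HA.
    pose proof (Cmod_ge_0 (K (p + s * e)%C - K (p + t * e)%C)). nra.
Qed.

(** * Goursat's theorem on rectangles *)

(** The contour integral of [K(z) dz], counterclockwise; [Ci] is the velocity on the vertical
    sides. *)
Definition rect (K : C -> C) (a b c d : R) : C :=
  (CInt (fun x => K (x, c)) a b + Ci * CInt (fun y => K (b, y)) c d
   - CInt (fun x => K (x, d)) a b - Ci * CInt (fun y => K (a, y)) c d)%C.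

Lemma rect_ext (K L : C -> C) (a b c d : R) :
  a <= b -> c <= d ->
  (forall x y, a <= x <= b -> c <= y <= d -> K (x, y) = L (x, y)) ->
  rect K a b c d = rect L a b c d.
Proof.
  intros Hab Hcd H. unfold rect.
  rewrite (CInt_ext (fun x => K (x, c)) (fun x => L (x, c))), (CInt_ext (fun x => K (x, d)) (fun x => L (x, d))),
    (CInt_ext (fun y => K (a, y)) (fun y => L (a, y))), (CInt_ext (fun y => K (b, y)) (fun y => L (b, y)));
    trivial; intros t Ht; apply H; lra.
Qed.

Lemma rect_plus (K L : C -> C) (a b c d : R) :
  a <= b -> c <= d ->
  (forall x y, a <= x <= b -> c <= y <= d -> ccont K (x, y)) ->
  (forall x y, a <= x <= b -> c <= y <= d -> ccont L (x, y)) ->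
  rect (fun z => K z + L z)%C a b c d = (rect K a b c d + rect L a b c d)%C.
Proof.
  intros Hab Hcd HK HL. unfold rect.
  rewrite !CInt_plus; trivial; try ring; intros t Ht;
    (apply ccont_rcont_h || apply ccont_rcont_v); (apply HK || apply HL); lra.
Qed.

(** The integrals over the common side [x = m] cancel. Only the horizontal sides are cut, so
    continuity is required there alone and the interior may contain a singular point. *)
Lemma rect_split_x (K : C -> C) (a m b c d : R) :
  a <= m <= b ->
  (forall x, a <= x <= b -> ccont K (x, c)) -> (forall x, a <= x <= b -> ccont K (x, d)) ->
  rect K a b c d = (rect K a m c d + rect K m b c d)%C.
Proof.
  intros [H1 H2] Hc Hd. unfold rect.
  rewrite (CInt_Chasles (fun x => K (x, c)) a m b), (CInt_Chasles (fun x => K (x, d)) a m b); trivial.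
  ring. all: intros; apply ccont_rcont_h; auto.
Qed.

Lemma rect_split_y (K : C -> C) (a b c m d : R) :
  c <= m <= d ->
  (forall y, c <= y <= d -> ccont K (a, y)) -> (forall y, c <= y <= d -> ccont K (b, y)) ->
  rect K a b c d = (rect K a b c m + rect K a b m d)%C.
Proof.
  intros [H1 H2] Hc Hd. unfold rect.
  rewrite (CInt_Chasles (fun y => K (a, y)) c m d), (CInt_Chasles (fun y => K (b, y)) c m d); trivial.
  ring. all: intros; apply ccont_rcont_v; auto.
Qed.

(** Perimeter times maximum. Only boundary points are constrained, so that the bound also applies
    around a singular point. *)
Lemma rect_bound (K : C -> C) (a b c d M : R) :
  a <= b -> c <= d ->
  (forall x y, a <= x <= b -> c <= y <= d -> x = a \/ x = b \/ y = c \/ y = d ->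
     ccont K (x, y) /\ Cmod (K (x, y)) <= M) ->
  Cmod (rect K a b c d) <= 2 * ((b - a) + (d - c)) * M.
Proof.
  intros Hab Hcd H. unfold rect.
  assert (HC : forall z, Cmod (Ci * z) = Cmod z) by (intros; rewrite Cmod_mult, Cmod_Ci; ring).
  assert (Hh : forall y, y = c \/ y = d -> Cmod (CInt (fun x => K (x, y)) a b) <= (b - a) * M).
  { intros y Hy. assert (c <= y <= d) by lra.
    apply CInt_bound; trivial; intros t Ht; [apply ccont_rcont_h|]; apply H; tauto. }
  assert (Hv : forall x, x = a \/ x = b -> Cmod (CInt (fun y => K (x, y)) c d) <= (d - c) * M).
  { intros x Hx. assert (a <= x <= b) by lra.
    apply CInt_bound; trivial; intros t Ht; [apply ccont_rcont_v|]; apply H; tauto. }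
  pose proof (Hh c ltac:(tauto)). pose proof (Hh d ltac:(tauto)).
  pose proof (Hv a ltac:(tauto)). pose proof (Hv b ltac:(tauto)).
  unfold Cminus.
  eapply Rle_trans. apply Cmod_triangle. rewrite Cmod_opp, HC.
  eapply Rle_trans. apply Rplus_le_compat_r. apply Cmod_triangle. rewrite Cmod_opp.
  eapply Rle_trans. apply Rplus_le_compat_r, Rplus_le_compat_r. apply Cmod_triangle. rewrite HC.
  lra.
Qed.

Lemma rect_primitive (F K : C -> C) (a b c d : R) :
  a <= b -> c <= d ->
  (forall x y, a <= x <= b -> c <= y <= d -> cdiff F (x, y) (K (x, y))) ->
  (forall x y, a <= x <= b -> c <= y <= d -> ccont K (x, y)) ->
  rect K a b c d = 0%C.
Proof.
  intros Hab Hcd HF HK.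
  assert (Eh : forall x y : R, (Ci * y + x * 1)%C = (x, y)).
  { intros. apply injective_projections; simpl; ring. }
  assert (Ev : forall x y : R, (x + y * Ci)%C = (x, y)).
  { intros. apply injective_projections; simpl; ring. }
  assert (Hh : forall y, c <= y <= d -> CInt (fun x => K (x, y)) a b = (F (b, y) - F (a, y))%C).
  { intros y Hy. rewrite <- !Eh, <- CInt_primitive with (K := K); trivial.
    - rewrite Cmult_1_l. apply CInt_ext; trivial. intros. rewrite Eh. reflexivity.
    - intros. rewrite Eh. apply HF; trivial.
    (* The integrand is extended to a function of [z] that depends on [Re z] only; its continuity
       follows from that of [K] because [|Re w - t|] is at most the distance from [w] to
       [(t, y)]. *)
    - intros t Ht. apply (ccont_rcont_h (fun z => K (Ci * y + Re z * 1)%C) t y).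
      intros eps He. destruct (HK t y Ht Hy eps He) as (e & He' & H). exists e. split. exact He'.
      intros w Hw. simpl Re. rewrite !Eh. apply H. eapply Rle_lt_trans; [|exact Hw].
      destruct w as [u v]. simpl Re.
      replace ((u, y) - (t, y))%C with (RtoC (Re ((u, v) - (t, y))%C)).
      rewrite Cmod_R. apply re_le_Cmod. apply injective_projections; simpl; ring. }
  assert (Hv : forall x, a <= x <= b -> (Ci * CInt (fun y => K (x, y)) c d)%C = (F (x, d) - F (x, c))%C).
  { intros x Hx. rewrite <- !Ev, <- CInt_primitive with (K := K); trivial.
    - f_equal. apply CInt_ext; trivial. intros. rewrite Ev. reflexivity.
    - intros. rewrite Ev. apply HF; trivial.
    - intros t Ht. apply rcont_eps. intros eps He. rewrite Ev.
      destruct (proj1 (rcont_eps _ _) (ccont_rcont_v K x t (HK x t Hx Ht)) eps He) as (e & He' & H).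
      exists e. split. exact He'. intros s Hs. rewrite Ev. auto. }
  unfold rect. rewrite !Hh, !Hv by lra. ring.
Qed.

Lemma nested_interval_point (a b : nat -> R) :
  (forall n, a n <= a (S n)) -> (forall n, b (S n) <= b n) -> (forall n, a n <= b n) ->
  exists x, forall n, a n <= x <= b n.
Proof.
  intros Ha Hb Hab.
  assert (Ha' : forall n k, a n <= a (n + k)%nat).
  { intros n k. induction k. rewrite Nat.add_0_r. lra. rewrite Nat.add_succ_r. eapply Rle_trans. exact IHk. apply Ha. }
  assert (Hb' : forall n k, b (n + k)%nat <= b n).
  { intros n k. induction k. rewrite Nat.add_0_r. lra. rewrite Nat.add_succ_r. eapply Rle_trans. apply Hb. exact IHk. }
  assert (H : forall n m, a n <= b m).
  { intros n m. eapply Rle_trans. apply (Ha' n m). eapply Rle_trans. apply Hab.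
    rewrite Nat.add_comm. apply Hb'. }
  destruct (completeness (fun x => exists n, x = a n)) as [x [Hx1 Hx2]].
  - exists (b 0%nat). intros y [n ->]. apply H.
  - exists (a 0%nat), 0%nat. reflexivity.
  - exists x. intros n. split. apply Hx1. exists n. reflexivity.
    apply Hx2. intros y [m ->]. apply H.
Qed.

Definition half_of (a b a' b' : R) : Prop :=
  a' = a /\ b' = (a + b) / 2 \/ a' = (a + b) / 2 /\ b' = b.

Lemma half_of_bounds (a b a' b' : R) :
  a <= b -> half_of a b a' b' -> a <= a' /\ b' <= b /\ b' - a' = (b - a) / 2.
Proof. intros Hab [[-> ->]|[-> ->]]; lra. Qed.

(** The threshold is quadratic in the half-perimeter, hence four times smaller on a quarter, while
    the four quarter integrals add up to the whole one. If all quarters stayed below their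
    threshold, so would the sum. *)
Lemma rect_quarter (K : C -> C) (a b c d eps : R) :
  a <= b -> c <= d ->
  (forall x y, a <= x <= b -> c <= y <= d -> ccont K (x, y)) ->
  eps * ((b - a) + (d - c)) ^ 2 < Cmod (rect K a b c d) ->
  exists a' b' c' d', half_of a b a' b' /\ half_of c d c' d' /\
    eps * ((b' - a') + (d' - c')) ^ 2 < Cmod (rect K a' b' c' d').
Proof.
  intros Hab Hcd HK H. apply NNPP. intros HN.
  assert (Hs : forall a' b' c' d', half_of a b a' b' -> half_of c d c' d' ->
    Cmod (rect K a' b' c' d') <= eps * ((b - a) + (d - c)) ^ 2 / 4).
  { intros a' b' c' d' H1 H2. apply Rnot_lt_le. intros H3. apply HN. exists a', b', c', d'.
    split. exact H1. split. exact H2.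
    destruct (half_of_bounds _ _ _ _ Hab H1) as (_ & _ & ->).
    destruct (half_of_bounds _ _ _ _ Hcd H2) as (_ & _ & ->).
    eapply Rle_lt_trans; [|exact H3]. right. field. }
  set (m := (a + b) / 2) in *. set (n := (c + d) / 2) in *.
  assert (a <= m <= b) by (unfold m; lra). assert (c <= n <= d) by (unfold n; lra).
  assert (L1 : half_of a b a m) by (left; auto). assert (L2 : half_of a b m b) by (right; auto).
  assert (L3 : half_of c d c n) by (left; auto). assert (L4 : half_of c d n d) by (right; auto).
  rewrite (rect_split_x K a m b), (rect_split_y K a m c n d), (rect_split_y K m b c n d) in H;
    trivial; try (intros; apply HK; lra).
  pose proof (Hs _ _ _ _ L1 L3). pose proof (Hs _ _ _ _ L1 L4).
  pose proof (Hs _ _ _ _ L2 L3). pose proof (Hs _ _ _ _ L2 L4).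
  pose proof (Cmod_triangle (rect K a m c n + rect K a m n d) (rect K m b c n + rect K m b n d)).
  pose proof (Cmod_triangle (rect K a m c n) (rect K a m n d)).
  pose proof (Cmod_triangle (rect K m b c n) (rect K m b n d)).
  lra.
Qed.

Lemma nested_bad_rectangles (K : C -> C) (a b c d eps : R) :
  a <= b -> c <= d ->
  (forall x y, a <= x <= b -> c <= y <= d -> ccont K (x, y)) ->
  eps * ((b - a) + (d - c)) ^ 2 < Cmod (rect K a b c d) ->
  exists xs ys, a <= xs <= b /\ c <= ys <= d /\ forall n : nat,
    exists a' b' c' d', a <= a' /\ a' <= xs <= b' /\ b' <= b /\ c <= c' /\ c' <= ys <= d' /\ d' <= d /\
      (b' - a') + (d' - c') = ((b - a) + (d - c)) / 2 ^ n /\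
      eps * ((b' - a') + (d' - c')) ^ 2 < Cmod (rect K a' b' c' d').
Proof.
  intros Hab Hcd HK H.
  set (bad := fun q : (R * R) * (R * R) => let '((a', b'), (c', d')) := q in
    a <= a' /\ a' <= b' /\ b' <= b /\ c <= c' /\ c' <= d' /\ d' <= d /\
    eps * ((b' - a') + (d' - c')) ^ 2 < Cmod (rect K a' b' c' d')).
  set (sub := fun q q' : (R * R) * (R * R) =>
    half_of (fst (fst q)) (snd (fst q)) (fst (fst q')) (snd (fst q')) /\
    half_of (fst (snd q)) (snd (snd q)) (fst (snd q')) (snd (snd q'))).
  (* The premise [bad q] sits inside the existential so that the step is total and one choice
     function can be iterated. *)
  assert (Hstep : forall q, exists q', bad q -> bad q' /\ sub q q').
  { intros q. destruct (classic (bad q)) as [Hq|Hq].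
    - destruct q as [[a1 b1] [c1 d1]]. destruct Hq as (Q1 & Q2 & Q3 & Q4 & Q5 & Q6 & Q7).
      destruct (rect_quarter K a1 b1 c1 d1 eps Q2 Q5) as (a2 & b2 & c2 & d2 & H1 & H2 & H3); trivial.
      intros; apply HK; lra.
      exists ((a2, b2), (c2, d2)). intros _. split; [|split; assumption].
      apply half_of_bounds in H1; trivial. apply half_of_bounds in H2; trivial.
      simpl. repeat split; lra.
    - exists q. tauto. }
  destruct (constructive_indefinite_description
    (fun f : (R * R) * (R * R) -> (R * R) * (R * R) => forall q, bad q -> bad (f q) /\ sub q (f q))) as [f Hf].
  { exists (fun q => proj1_sig (constructive_indefinite_description _ (Hstep q))).
    intros q. apply proj2_sig. }
  set (q := fun n => Nat.iter n f ((a, b), (c, d))).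
  assert (Hq : forall n, bad (q n)).
  { intros n. induction n as [|n IH]. simpl. repeat split; try lra; assumption. apply Hf. exact IH. }
  assert (Hs : forall n, sub (q n) (q (S n))) by (intros n; apply Hf, Hq).
  set (an := fun n => fst (fst (q n))). set (bn := fun n => snd (fst (q n))).
  set (cn := fun n => fst (snd (q n))). set (dn := fun n => snd (snd (q n))).
  assert (Hb : forall n, a <= an n /\ an n <= bn n /\ bn n <= b /\ c <= cn n /\ cn n <= dn n /\ dn n <= d /\
    eps * ((bn n - an n) + (dn n - cn n)) ^ 2 < Cmod (rect K (an n) (bn n) (cn n) (dn n))).
  { intros n. pose proof (Hq n) as G. unfold an, bn, cn, dn. destruct (q n) as [[a1 b1] [c1 d1]]. exact G. }
  assert (H1 : forall n, an n <= an (S n) /\ bn (S n) <= bn n /\ bn (S n) - an (S n) = (bn n - an n) / 2).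
  { intros n. apply half_of_bounds. apply Hb. apply Hs. }
  assert (H2 : forall n, cn n <= cn (S n) /\ dn (S n) <= dn n /\ dn (S n) - cn (S n) = (dn n - cn n) / 2).
  { intros n. apply half_of_bounds. apply Hb. apply Hs. }
  destruct (nested_interval_point an bn) as [xs Hx]; try (intros; apply H1 || apply Hb).
  destruct (nested_interval_point cn dn) as [ys Hy]; try (intros; apply H2 || apply Hb).
  exists xs, ys. pose proof (Hx 0%nat). pose proof (Hy 0%nat). split. assumption. split. assumption.
  intros n. exists (an n), (bn n), (cn n), (dn n).
  destruct (Hb n) as (Q1 & Q2 & Q3 & Q4 & Q5 & Q6 & Q7).
  pose proof (Hx n). pose proof (Hy n). repeat split; try lra.
  induction n as [|n IH]. simpl. unfold an, bn, cn, dn; simpl. field.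
  destruct (H1 n) as (_ & _ & E1). destruct (H2 n) as (_ & _ & E2). rewrite E1, E2.
  destruct (Hb n) as (P1 & P2 & P3 & P4 & P5 & P6 & P7).
  replace ((bn n - an n) / 2 + (dn n - cn n) / 2) with (((bn n - an n) + (dn n - cn n)) / 2) by field.
  rewrite IH; auto. simpl. field. apply pow_nonzero. lra.
Qed.

(** If the integral is nonzero, the nested bad rectangles close in on a point [z0], near which [K]
    is affine up to [(eps / 2) |z - z0|]. The affine part has a primitive and integrates to 0; on a
    small rectangle of half-perimeter [p] the remainder contributes at most
    [2 p (eps / 2) p = eps p^2], against the strict lower bound. *)
Theorem goursat (K : C -> C) (a b c d : R) :
  a <= b -> c <= d ->
  (forall x y, a <= x <= b -> c <= y <= d -> exists l, cdiff K (x, y) l) ->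
  rect K a b c d = 0%C.
Proof.
  intros Hab Hcd HK.
  assert (HKc : forall x y, a <= x <= b -> c <= y <= d -> ccont K (x, y)).
  { intros x y Hx Hy. destruct (HK x y Hx Hy) as [l Hl]. exact (cdiff_ccont _ _ _ Hl). }
  apply Cmod_eq_0. apply Rle_antisym; [|apply Cmod_ge_0].
  set (P := (b - a) + (d - c)). assert (HP : 0 <= P) by (unfold P; lra).
  apply Rnot_lt_le. intros Hpos.
  (* [P + 1] instead of [P] covers degenerate rectangles; the factor 2 makes [Hbad] strict. *)
  set (eps := Cmod (rect K a b c d) / (2 * (P + 1) ^ 2)).
  assert (HP1 : 0 < (P + 1) ^ 2) by (apply pow_lt; lra).
  assert (Heps : 0 < eps) by (apply Rdiv_lt_0_compat; lra).
  assert (Hbad : eps * P ^ 2 < Cmod (rect K a b c d)).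
  { apply Rle_lt_trans with (eps * (P + 1) ^ 2). apply Rmult_le_compat_l; nra.
    unfold eps. replace (Cmod (rect K a b c d) / (2 * (P + 1) ^ 2) * (P + 1) ^ 2)
      with (Cmod (rect K a b c d) / 2). lra. field. lra. }
  destruct (nested_bad_rectangles K a b c d eps Hab Hcd HKc Hbad) as (xs & ys & Hxs & Hys & Hn).
  destruct (HK xs ys Hxs Hys) as [l Hl].
  destruct (proj1 (cderiv_eps _ _ _) (proj2 (cderiv_cdiff _ _ _) Hl) (eps / 2)) as (r & Hr & Hd).
  { lra. }
  assert (Hex : exists n, P / 2 ^ n < r).
  { destruct (pow_lt_1_zero (/ 2)) with (y := r / (P + 1)) as [n Hn'].
    rewrite Rabs_pos_eq; lra. apply Rdiv_lt_0_compat; lra.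
    exists n. specialize (Hn' n (Nat.le_refl n)). rewrite Rabs_pos_eq in Hn'. 2: apply pow_le; lra.
    rewrite pow_inv in Hn'. apply Rlt_div_r in Hn'. 2: lra.
    assert (0 < / 2 ^ n) by (apply Rinv_0_lt_compat, pow_lt; lra).
    unfold Rdiv. nra. }
  destruct Hex as [n Hnr].
  destruct (Hn n) as (a' & b' & c' & d' & A1 & A2 & A3 & A4 & A5 & A6 & A7 & A8).
  fold P in A7. set (p := (b' - a') + (d' - c')) in *.
  set (z0 := (xs, ys) : C) in *.
  set (L := fun z : C => (K z0 + l * (z - z0))%C).
  assert (HL : forall z, cdiff L z l).
  { intros z. eapply cdiff_eq.
    exact (cdiff_plus _ _ _ _ _ (cdiff_const (K z0) z) (cdiff_scal _ l _ _ (cdiff_shift z0 z))). ring. }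
  set (Rm := fun z : C => (K z + (- (1)) * L z)%C).
  assert (HLc : forall z, ccont L z) by (intros z; exact (cdiff_ccont _ _ _ (HL z))).
  assert (HRc : forall x y, a' <= x <= b' -> c' <= y <= d' -> ccont Rm (x, y)).
  { intros x y Hx Hy. apply ccont_plus. apply HKc; lra. apply ccont_mult. apply ccont_const. apply HLc. }
  assert (E : rect K a' b' c' d' = rect Rm a' b' c' d').
  { transitivity (rect (fun z => L z + Rm z)%C a' b' c' d').
    { apply rect_ext; try lra. intros. unfold Rm. ring. }
    rewrite rect_plus; try lra; [| intros; apply HLc | exact HRc].
    rewrite (rect_primitive (fun z => K z0 * z + l / 2 * ((z - z0) * (z - z0)))%C L); try lra; [ring | |].
    - intros x y _ _. set (z := (x, y) : C).
      eapply cdiff_eq.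
      exact (cdiff_plus _ _ _ _ _ (cdiff_scal _ (K z0) _ _ (cdiff_id z))
        (cdiff_scal _ (l / 2) _ _ (cdiff_mult _ _ _ _ _ (cdiff_shift z0 z) (cdiff_shift z0 z)))).
      unfold L. cbv beta. field.
    - intros; apply HLc. }
  rewrite E in A8. apply (Rlt_irrefl (eps * p ^ 2)). eapply Rlt_le_trans. exact A8.
  replace (eps * p ^ 2) with (2 * p * (eps / 2 * p)) by field.
  apply rect_bound; try lra. intros x y Hx Hy _. split. auto.
  assert (Hz : Cmod ((x, y) - z0) <= p).
  { replace ((x, y) - z0)%C with (RtoC (x - xs) + RtoC (y - ys) * Ci)%C
      by (apply injective_projections; simpl; ring).
    eapply Rle_trans. apply Cmod_triangle. rewrite Cmod_mult, Cmod_Ci, !Cmod_R.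
    assert (Rabs (x - xs) <= b' - a') by (apply Rabs_le; lra).
    assert (Rabs (y - ys) <= d' - c') by (apply Rabs_le; lra). unfold p. lra. }
  unfold Rm. replace (K (x, y) + - (1) * L (x, y))%C with (K (x, y) - K z0 - l * ((x, y) - z0))%C
    by (unfold L; ring).
  eapply Rle_trans. apply Hd. lra. apply Rmult_le_compat_l; lra.
Qed.

(* A bounded singularity is harmless: the boundary integral equals the one over an
   arbitrarily small square around it. *)
Theorem goursat_bounded (K : C -> C) (a b c d x0 y0 r M : R) :
  a < x0 < b -> c < y0 < d -> 0 < r ->
  (forall x y, a <= x <= b -> c <= y <= d -> (x, y) <> (x0, y0) -> exists l, cdiff K (x, y) l) ->
  (forall x y, Rabs (x - x0) < r -> Rabs (y - y0) < r -> (x, y) <> (x0, y0) -> Cmod (K (x, y)) <= M) ->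
  rect K a b c d = 0%C.
Proof.
  intros Hx0 Hy0 Hr HK HM.
  assert (HKc : forall x y, a <= x <= b -> c <= y <= d -> x <> x0 \/ y <> y0 -> ccont K (x, y)).
  { intros x y Hx Hy Hn. destruct (HK x y Hx Hy) as [l Hl]. intros E; injection E; lra.
    exact (cdiff_ccont _ _ _ Hl). }
  assert (Hnn : 0 <= M).
  { eapply Rle_trans. apply Cmod_ge_0. apply (HM (x0 + r / 2) y0).
    rewrite Rabs_pos_eq; lra. rewrite Rminus_diag, Rabs_R0. lra. intros E; injection E; lra. }
  apply Cmod_eq_0. apply Rle_antisym; [|apply Cmod_ge_0].
  apply le_epsilon. intros eps Heps.
  (* Half the side of the square around the singularity: it must fit into the rectangle and into the
     region where [M] is a bound, and its perimeter [8 e] times [M] must not exceed [eps]. [M + 1]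
     avoids a zero denominator. *)
  set (e := Rmin (Rmin (r / 2) (Rmin (x0 - a) (b - x0))) (Rmin (Rmin (y0 - c) (d - y0)) (eps / (8 * (M + 1))))).
  assert (He : 0 < e /\ e <= r / 2 /\ e <= x0 - a /\ e <= b - x0 /\ e <= y0 - c /\ e <= d - y0 /\ e <= eps / (8 * (M + 1))).
  { assert (0 < eps / (8 * (M + 1))) by (apply Rdiv_lt_0_compat; lra).
    unfold e, Rmin. repeat destruct Rle_dec; lra. }
  clearbody e. destruct He as (E0 & E1 & E2 & E3 & E4 & E5 & E6).
  (* The cuts below leave five pieces; this disposes of the four that miss the singular point. *)
  assert (Z : forall a' b' c' d', a <= a' -> a' <= b' -> b' <= b -> c <= c' -> c' <= d' -> d' <= d ->
    (b' < x0 \/ x0 < a' \/ d' < y0 \/ y0 < c') -> rect K a' b' c' d' = 0%C).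
  { intros. apply goursat; trivial. intros x y Hx Hy. apply HK; try lra. intros E; injection E; lra. }
  rewrite (rect_split_x K a (x0 - e) b), (rect_split_x K (x0 - e) (x0 + e) b),
    (rect_split_y K (x0 - e) (x0 + e) c (y0 - e) d), (rect_split_y K (x0 - e) (x0 + e) (y0 - e) (y0 + e) d);
    try lra; try (intros; apply HKc; lra).
  rewrite (Z a), (Z (x0 + e)), (Z (x0 - e) (x0 + e) c), (Z (x0 - e) (x0 + e) (y0 + e)); try lra.
  match goal with |- Cmod ?t <= _ => replace t with (rect K (x0 - e) (x0 + e) (y0 - e) (y0 + e)) by ring end.
  eapply Rle_trans. apply rect_bound with (M := M); try lra.
  - intros x y Hx Hy Hb. split. apply HKc; lra.
    apply HM; try (apply Rabs_def1; lra). intros E; injection E; lra.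
  - apply Rle_div_r in E6; lra.
Qed.

(** * The maximum principle on the punctured disc *)

Definition cexp (z : C) : C := (exp (Re z) * cos (Im z), exp (Re z) * sin (Im z)).

Lemma cexp_plus (z w : C) : cexp (z + w) = (cexp z * cexp w)%C.
Proof.
  destruct z as [x y], w as [u v]. unfold cexp. simpl. rewrite exp_plus, cos_plus, sin_plus.
  apply injective_projections; simpl; ring.
Qed.

Lemma Cmod_cexp (z : C) : Cmod (cexp z) = exp (Re z).
Proof.
  unfold cexp, Cmod. simpl fst; simpl snd.
  replace ((exp (Re z) * cos (Im z)) ^ 2 + (exp (Re z) * sin (Im z)) ^ 2) with ((exp (Re z)) ^ 2).
  - apply sqrt_pow2. left; apply exp_pos.
  - transitivity (exp (Re z) ^ 2 * (Rsqr (sin (Im z)) + Rsqr (cos (Im z)))).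
    rewrite sin2_cos2. ring. unfold Rsqr. ring.
Qed.

Lemma cexp_neq_0 (z : C) : cexp z <> 0%C.
Proof. apply Cmod_gt_0. rewrite Cmod_cexp. apply exp_pos. Qed.

Lemma cexp_periodic (x y : R) : cexp (x, y + PI) = cexp (x, y - PI).
Proof.
  unfold cexp. simpl. replace (y + PI) with (y - PI + PI + PI) by ring.
  rewrite !neg_cos, !neg_sin, !Ropp_involutive. reflexivity.
Qed.

(** The angle is [acos (u / r)] with the sign of [v]. The closed range makes each circle the image
    of a compact interval, and halving the angle gives a nonnegative cosine. *)
Lemma polar_form (z : C) : z <> 0%C -> exists x y, - PI <= y <= PI /\ z = cexp (x, y).
Proof.
  intros Hz. assert (Hr : 0 < Cmod z) by (apply Cmod_gt_0; exact Hz).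
  destruct z as [u v]. set (r := Cmod (u, v)) in *.
  assert (Er : r ^ 2 = u ^ 2 + v ^ 2).
  { unfold r, Cmod. simpl fst; simpl snd. rewrite pow2_sqrt; nra. }
  assert (Hu : -1 <= u / r <= 1).
  { pose proof (re_le_Cmod (u, v)) as H. simpl Re in H. fold r in H. apply Rabs_le_between in H.
    split; [apply Rle_div_r | apply Rle_div_l]; lra. }
  assert (Hs : sqrt (1 - (u / r)²) = Rabs (v / r)).
  { rewrite <- sqrt_Rsqr_abs. f_equal. unfold Rsqr.
    apply (Rmult_eq_reg_r (r ^ 2)). 2: apply pow_nonzero; lra. field_simplify; try lra. }
  exists (ln r), (if Rle_dec 0 v then acos (u / r) else - acos (u / r)).
  split. { pose proof (acos_bound (u / r)). destruct Rle_dec; lra. }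
  unfold cexp. simpl Re; simpl Im. rewrite exp_ln by exact Hr.
  destruct (Rle_dec 0 v) as [Hv|Hv]; apply injective_projections; simpl fst; simpl snd;
    rewrite ?cos_neg, ?sin_neg, ?cos_acos, ?sin_acos, ?Hs by exact Hu.
  - field; lra.
  - rewrite Rabs_pos_eq. field; lra. apply Rdiv_le_0_compat; lra.
  - field; lra.
  - rewrite Rabs_left. field; lra. apply Rlt_div_l; lra.
Qed.

Lemma derivable_pt_lim_0_eps (f : R -> R) (l : R) :
  derivable_pt_lim f 0 l -> forall eps, 0 < eps -> exists d, 0 < d /\
  forall x, Rabs x < d -> Rabs (f x - f 0 - l * x) <= eps * Rabs x.
Proof.
  intros H eps He. destruct (H eps He) as [d Hd]. exists d. split. apply cond_pos.
  intros x Hx. destruct (Req_dec x 0) as [->|Hn].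
  - replace (f 0 - f 0 - l * 0) with 0 by ring. rewrite Rabs_R0. lra.
  - specialize (Hd x Hn Hx). rewrite Rplus_0_l in Hd.
    replace (f x - f 0 - l * x) with (((f x - f 0) / x - l) * x) by (field; exact Hn).
    rewrite Rabs_mult. apply Rmult_le_compat_r. apply Rabs_pos. lra.
Qed.

Lemma cdiff_cexp_0 : cdiff cexp 0 1.
Proof.
  apply cderiv_cdiff, cderiv_eps. intros eps He.
  (* With [m = |w|] the error splits into four terms of size at most [e m], [3 e m], [3 e m] and
     [2 e m], which sum to [9 e m]; [e <= 1] yields [exp x <= 3] and [|exp x - 1| <= 2 |x|]. *)
  set (e := Rmin 1 (eps / 9)).
  assert (He1 : 0 < e /\ e <= 1 /\ 9 * e <= eps) by (unfold e, Rmin; destruct Rle_dec; lra).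
  clearbody e. destruct He1 as (E0 & E1 & E2).
  destruct (derivable_pt_lim_0_eps exp 1 derivable_pt_lim_exp_0 e E0) as (d1 & D1 & H1).
  destruct (derivable_pt_lim_0_eps cos 0 derivable_pt_lim_cos_0 e E0) as (d2 & D2 & H2).
  destruct (derivable_pt_lim_0_eps sin 1 derivable_pt_lim_sin_0 e E0) as (d3 & D3 & H3).
  exists (Rmin (Rmin d1 d2) (Rmin d3 e)). split. { repeat apply Rmin_glb_lt; assumption. }
  intros w Hw. replace (w - 0)%C with w in * by ring.
  assert (Hd : Cmod w < d1 /\ Cmod w < d2 /\ Cmod w < d3 /\ Cmod w < e).
  { revert Hw. unfold Rmin. repeat destruct Rle_dec; lra. }
  destruct w as [x y].
  assert (Hx := re_le_Cmod (x, y)). simpl Re in Hx.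
  assert (Hy : Rabs y <= Cmod (x, y)) by exact (Rle_trans _ _ _ (Rmax_r _ _) (Rmax_Cmod (x, y))).
  set (m := Cmod (x, y)) in *.
  specialize (H1 x ltac:(lra)). specialize (H2 y ltac:(lra)). specialize (H3 y ltac:(lra)).
  rewrite exp_0 in H1. rewrite cos_0 in H2. rewrite sin_0 in H3.
  assert (Hex : Rabs (exp x - 1) <= 2 * Rabs x).
  { replace (exp x - 1) with ((exp x - 1 - 1 * x) + x) by ring.
    eapply Rle_trans. apply Rabs_triang. pose proof (Rabs_pos x). nra. }
  assert (Hex3 : exp x <= 3).
  { pose proof (Rle_abs (exp x - 1)). lra. }
  pose proof (exp_pos x) as Hep. pose proof (Rabs_pos x). pose proof (Rabs_pos y).
  replace (cexp (x, y) - cexp 0 - 1 * (x, y))%C with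
    (RtoC ((exp x - 1 - 1 * x) + exp x * (cos y - 1 - 0 * y)) +
     RtoC (exp x * (sin y - 0 - 1 * y) + (exp x - 1) * y) * Ci)%C.
  2: { unfold cexp. simpl. rewrite exp_0, cos_0, sin_0. apply injective_projections; simpl; ring. }
  eapply Rle_trans. apply Cmod_triangle. rewrite Cmod_mult, Cmod_Ci, !Cmod_R.
  eapply Rle_trans. apply Rplus_le_compat. apply Rabs_triang.
  apply Rmult_le_compat_r. lra. apply Rabs_triang.
  rewrite !Rabs_mult, (Rabs_pos_eq (exp x)) by lra.
  assert (exp x * Rabs (cos y - 1 - 0 * y) <= 3 * (e * m)).
  { apply Rmult_le_compat; try lra. apply Rabs_pos. eapply Rle_trans. exact H2. apply Rmult_le_compat_l; lra. }
  assert (exp x * Rabs (sin y - 0 - 1 * y) <= 3 * (e * m)).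
  { apply Rmult_le_compat; try lra. apply Rabs_pos. eapply Rle_trans. exact H3. apply Rmult_le_compat_l; lra. }
  assert (Rabs (exp x - 1) * Rabs y <= (2 * e) * m).
  { apply Rmult_le_compat; try lra. apply Rabs_pos. }
  assert (e * Rabs x <= e * m) by (apply Rmult_le_compat_l; lra).
  nra.
Qed.

(** The functional equation [cexp w = cexp z * cexp (w - z)] carries the derivative at 0 to every
    point. *)
Lemma cdiff_cexp (z : C) : cdiff cexp z (cexp z).
Proof.
  apply cdiff_local with (f := fun w => (cexp z * cexp (w - z))%C) (d := 1). lra.
  { intros w _. rewrite <- cexp_plus. f_equal. ring. }
  eapply cdiff_eq. apply cdiff_scal. apply (cdiff_comp cexp (fun w => w - z)%C z 1 1).
  replace (z - z)%C with (RtoC 0) by ring. exact cdiff_cexp_0. apply cdiff_shift. ring.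
Qed.

(** Equal moduli give [x = x0]; then [cos (y - y0) = 1], so the sine of the half angle vanishes, and
    that half angle lies in [[-PI/2, PI/2]]. The closed bound [PI] matches the strip of height
    [2 PI] centred at [y0]. *)
Lemma cexp_inj (x y x0 y0 : R) :
  Rabs (y - y0) <= PI -> cexp (x, y) = cexp (x0, y0) -> x = x0 /\ y = y0.
Proof.
  intros Hy E.
  assert (Ex : x = x0).
  { apply exp_inv. pose proof (f_equal Cmod E) as Em. rewrite !Cmod_cexp in Em. exact Em. }
  split. exact Ex. subst x0. unfold cexp in E. simpl in E. injection E as E1 E2.
  apply Rmult_eq_reg_l in E1, E2; try (apply Rgt_not_eq, exp_pos).
  assert (Hc : cos (2 * ((y - y0) / 2)) = 1).
  { replace (2 * ((y - y0) / 2)) with (y - y0) by field.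
    rewrite cos_minus, E1, E2. pose proof (sin2_cos2 y0) as H. unfold Rsqr in H. lra. }
  rewrite cos_2a_sin in Hc.
  assert (Hs : sin ((y - y0) / 2) = 0) by nra.
  pose proof PI_RGT_0. apply Rabs_le_between in Hy.
  destruct (Rtotal_order y y0) as [H'|[H'|H']]; trivial; exfalso.
  - assert (0 < sin (- ((y - y0) / 2))) by (apply sin_gt_0; lra). rewrite sin_neg in *. lra.
  - assert (0 < sin ((y - y0) / 2)) by (apply sin_gt_0; lra). lra.
Qed.

(** The integral of [k(z) dz / (i z)] over the circle of radius [exp x]. Starting at the angle
    [y0 - PI] puts a singular point of angle [y0] in the middle of the strip, off the horizontal
    sides. *)
Definition circle_int (k : C -> C) (x y0 : R) : C :=
  CInt (fun y => k (cexp (x, y))) (y0 - PI) (y0 + PI).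

Lemma cdiff_comp_cexp (k : C -> C) (z l : C) :
  cdiff k (cexp z) l -> exists m, cdiff (fun w => k (cexp w)) z m.
Proof. intros H. eexists. exact (cdiff_comp _ _ _ _ _ H (cdiff_cexp z)). Qed.

Lemma rcont_circle (k : C -> C) (x y : R) :
  (exists l, cdiff k (cexp (x, y)) l) -> rcont (fun t => k (cexp (x, t))) y.
Proof.
  intros [l H]. destruct (cdiff_comp_cexp _ _ _ H) as [m Hm].
  exact (ccont_rcont_v _ _ _ (cdiff_ccont _ _ _ Hm)).
Qed.

(** In the logarithmic coordinate the annulus is a rectangle of height [2 PI], in which [k] composed
    with [cexp] has a single, bounded singularity. Its boundary integral is 0 and the horizontal
    sides cancel by periodicity, which leaves the two vertical sides, that is, the two circles. *)
Lemma circle_int_const (k : C -> C) (x1 x0 x2 y0 r M : R) :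
  x1 < x0 < x2 -> 0 < r ->
  (forall z, exp x1 <= Cmod z <= exp x2 -> z <> cexp (x0, y0) -> exists l, cdiff k z l) ->
  (forall z, Cmod (z - cexp (x0, y0)) < r -> z <> cexp (x0, y0) -> Cmod (k z) <= M) ->
  circle_int k x1 y0 = circle_int k x2 y0.
Proof.
  intros Hx Hr Hk HM. pose proof PI_RGT_0 as Hpi.
  assert (HK : forall x y, x1 <= x <= x2 -> y0 - PI <= y <= y0 + PI -> (x, y) <> (x0, y0) ->
    exists l, cdiff (fun w => k (cexp w)) (x, y) l).
  { intros x y H1 H2 Hn. destruct (Hk (cexp (x, y))) as [l Hl].
    - rewrite Cmod_cexp. simpl Re. split; apply Rnot_lt_le; intros G; apply exp_lt_inv in G; lra.
    - intros E. apply Hn. destruct (cexp_inj x y x0 y0) as [-> ->]; trivial. apply Rabs_le; lra.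
    - exact (cdiff_comp_cexp _ _ _ Hl). }
  destruct (cdiff_ccont _ _ _ (cdiff_cexp (x0, y0)) r Hr) as (d & Hd & Hc).
  assert (H0 : rect (fun w => k (cexp w)) x1 x2 (y0 - PI) (y0 + PI) = 0%C).
  { apply goursat_bounded with (x0 := x0) (y0 := y0) (r := Rmin (d / 2) PI) (M := M); trivial; try lra.
    apply Rmin_glb_lt; lra.
    intros x y H1 H2 Hn.
    assert (H1' := Rlt_le_trans _ _ _ H1 (Rmin_l _ _)). assert (H2' := Rlt_le_trans _ _ _ H2 (Rmin_l _ _)).
    apply HM.
    - apply Hc. replace ((x, y) - (x0, y0))%C with (RtoC (x - x0) + RtoC (y - y0) * Ci)%C
        by (apply injective_projections; simpl; ring).
      eapply Rle_lt_trans. apply Cmod_triangle. rewrite Cmod_mult, Cmod_Ci, !Cmod_R. lra.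
    - intros E. apply Hn. destruct (cexp_inj x y x0 y0) as [-> ->]; trivial.
      left. exact (Rlt_le_trans _ _ _ H2 (Rmin_r _ _)). }
  unfold rect in H0. unfold circle_int.
  rewrite (CInt_ext (fun x => k (cexp (x, y0 + PI))) (fun x => k (cexp (x, y0 - PI)))) in H0; try lra.
  2: intros; rewrite cexp_periodic; reflexivity.
  match type of H0 with (?p + Ci * ?u - _ - Ci * ?v)%C = _ =>
    assert (E : (Ci * (u - v))%C = 0%C) by (rewrite <- H0; ring);
    replace v with (u - (u - v))%C by ring; destruct (Ceq_dec (u - v) 0) as [->|N] end.
  ring. exfalso. revert E. apply Cmult_neq_0; trivial. intros E. injection E. lra.
Qed.

(** Twice the real part minus 1 equals [(|z|^2 - |a|^2) / |z - a|^2], the Poisson kernel, which is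
    positive. *)
Lemma Re_cauchy_kernel (z a : C) : Cmod a < Cmod z -> 1 / 2 <= Re (z / (z - a)).
Proof.
  intros H. destruct z as [u v], a as [p q].
  assert (H2 : p ^ 2 + q ^ 2 < u ^ 2 + v ^ 2).
  { apply Rnot_le_lt. intros H'. apply (Rlt_not_le _ _ H). unfold Cmod. simpl fst; simpl snd. apply sqrt_le_1_alt. exact H'. }
  assert (HD : 0 < (u - p) ^ 2 + (v - q) ^ 2).
  { pose proof (pow2_ge_0 (u - p)). pose proof (pow2_ge_0 (v - q)).
    destruct (Req_dec (u - p) 0) as [Eu|Nu]; [destruct (Req_dec (v - q) 0) as [Ev|Nv]|].
    - replace u with p in H2 by lra. replace v with q in H2 by lra. lra.
    - apply pow2_gt_0 in Nv. lra.
    - apply pow2_gt_0 in Nu. lra. }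
  replace (Re ((u, v) / ((u, v) - (p, q)))) with ((u * (u - p) + v * (v - q)) / ((u - p) ^ 2 + (v - q) ^ 2)).
  - apply (Rle_div_r (1 / 2) _ _ HD). nra.
  - simpl. field. apply Rgt_not_eq; nra.
Qed.

(* Cauchy's formula for [F a] on the circle of radius [rho], weakened to an estimate:
   the divided difference [(F z - F a) z / (z - a)] has mean [0] on small circles, hence
   on all circles, and the kernel [z / (z - a)] has real part at least [1/2]. *)
Lemma cauchy_estimate (F : C -> C) (rho M : R) (a : C) :
  (forall z : C, z <> 0%C -> Cmod z < 1 -> exists l, cdiff F z l) ->
  (forall eps, 0 < eps -> exists d, 0 < d /\
     forall z : C, z <> 0%C -> Cmod z < d -> Cmod (z * F z) <= eps) ->
  0 < rho < 1 -> (forall z, Cmod z = rho -> Cmod (F z) <= M) ->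
  a <> 0%C -> Cmod a < rho ->
  Cmod (F a) <= 2 * (M * (rho / (rho - Cmod a))).
Proof.
  intros HF HF0 Hrho HM Ha Har. pose proof PI_RGT_0 as Hpi.
  destruct (polar_form a Ha) as (x0 & y0 & _ & Ea).
  assert (Hma : Cmod a = exp x0) by (rewrite Ea; apply Cmod_cexp).
  set (m := Cmod a) in *. assert (Hm : 0 < m) by (rewrite Hma; apply exp_pos).
  set (kap := fun z : C => (z / (z - a))%C).
  set (k := fun z : C => ((F z - F a) * kap z)%C).
  assert (Hsub : forall z, z <> a -> (z - a)%C <> 0%C).
  { intros z Hz E. apply Hz. replace z with (z - a + a)%C by ring. rewrite E. ring. }
  assert (Hkap : forall z, z <> a -> exists l, cdiff kap z l).
  { intros z Hz. eexists. apply (cdiff_mult (fun w => w)). apply cdiff_id.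
    apply (cdiff_inv (fun w => w - a)%C). auto. apply cdiff_shift. }
  assert (Hk : forall z : C, z <> 0%C -> Cmod z < 1 -> z <> a -> exists l, cdiff k z l).
  { intros z Hz Hz1 Hza. destruct (HF z Hz Hz1) as [l Hl]. destruct (Hkap z Hza) as [l' Hl'].
    eexists. apply (cdiff_mult (fun w => F w - F a)%C kap).
    exact (cdiff_plus _ _ _ _ _ Hl (cdiff_const (- F a) z)). exact Hl'. }
  (* With the slope function [phi] of [F] at [a], [k z = phi z * z] near [a], so the singularity of
     [k] at [a] is bounded. *)
  assert (Hbd : exists r B, 0 < r /\ forall z, Cmod (z - a) < r -> z <> a -> Cmod (k z) <= B).
  { destruct (HF a Ha) as [l Hl]. fold m; lra.
    destruct Hl as (phi & _ & Hp & d & Hd & H).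
    destruct (Hp 1 Rlt_0_1) as (d' & Hd' & H').
    exists (Rmin (Rmin d d') 1), ((Cmod (phi a) + 1) * (m + 1)).
    split. { repeat apply Rmin_glb_lt; lra. }
    intros z Hz Hza.
    assert (Hz' : Cmod (z - a) < d /\ Cmod (z - a) < d' /\ Cmod (z - a) < 1).
    { revert Hz. unfold Rmin. repeat destruct Rle_dec; lra. }
    destruct Hz' as (Z1 & Z2 & Z3).
    unfold k, kap. rewrite (H z Z1).
    replace ((F a + phi z * (z - a) - F a) * (z / (z - a)))%C with (phi z * z)%C by (field; auto).
    rewrite Cmod_mult. specialize (H' z Z2).
    pose proof (Cmod_triangle_rev (phi z) (phi a)). pose proof (Cmod_triangle_rev z a).
    apply Rmult_le_compat; try apply Cmod_ge_0; unfold m in *; lra. }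
  destruct Hbd as (r & B & Hr & HB).
  set (x2 := ln rho). assert (Ex2 : exp x2 = rho) by (apply exp_ln; lra).
  assert (Hx02 : x0 < x2) by (apply exp_lt_inv; lra).
  assert (Hc2 : forall y, Cmod (cexp (x2, y)) = rho) by (intros; rewrite Cmod_cexp; exact Ex2).
  assert (Hne2 : forall y, cexp (x2, y) <> a).
  { intros y E. pose proof (Hc2 y) as E'. rewrite E in E'. fold m in E'. lra. }
  assert (HA : circle_int k x2 y0 = 0%C).
  { apply Cmod_eq_0. apply Rle_antisym; [|apply Cmod_ge_0].
    apply le_epsilon. intros eps He. rewrite Rplus_0_l.
    (* On a circle of radius [r1 <= m / 2] one has [|z - a| >= m / 2], and [|z F z|] and [|z F a|]
       are each at most [eta]; so [|k| <= 4 eta / m = eps / (2 PI)], and the interval of integration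
       has length [2 PI]. *)
    set (eta := eps / (2 * PI) * (m / 4)).
    assert (Heta : 0 < eta) by (apply Rmult_lt_0_compat; apply Rdiv_lt_0_compat; lra).
    destruct (HF0 eta Heta) as (d & Hd & HFd).
    set (r1 := Rmin (Rmin (m / 2) (d / 2)) (eta / (Cmod (F a) + 1))).
    pose proof (Cmod_ge_0 (F a)) as HFa.
    assert (Hr1 : 0 < r1 /\ r1 <= m / 2 /\ r1 <= d / 2 /\ r1 <= eta / (Cmod (F a) + 1)).
    { assert (0 < eta / (Cmod (F a) + 1)) by (apply Rdiv_lt_0_compat; lra).
      unfold r1, Rmin. repeat destruct Rle_dec; lra. }
    clearbody r1. destruct Hr1 as (R0 & R1 & R2 & R3).
    apply Rle_div_r in R3; [|lra].
    set (x1 := ln r1). assert (Ex1 : exp x1 = r1) by (apply exp_ln; lra).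
    assert (Hx10 : x1 < x0) by (apply exp_lt_inv; lra).
    rewrite <- (circle_int_const k x1 x0 x2 y0 r B); trivial; try lra.
    2: { intros z [Hz1 Hz2] Hz. rewrite <- Ea in Hz. rewrite Ex1 in Hz1. rewrite Ex2 in Hz2.
         apply Hk; trivial; try lra. apply Cmod_gt_0. lra. }
    2: { rewrite <- Ea. exact HB. }
    replace eps with ((y0 + PI - (y0 - PI)) * (eps / (2 * PI))) by (field; lra).
    assert (Hc1 : forall y, Cmod (cexp (x1, y)) = r1) by (intros; rewrite Cmod_cexp; exact Ex1).
    apply CInt_bound. lra.
    - intros y _. apply rcont_circle. apply Hk. apply cexp_neq_0. rewrite Hc1; lra.
      intros E. pose proof (Hc1 y) as E'. rewrite E in E'. fold m in E'. lra.
    - intros y _. set (z := cexp (x1, y)). assert (Hz : Cmod z = r1) by apply Hc1.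
      assert (Hza : z <> a) by (intros E; rewrite E in Hz; fold m in Hz; lra).
      unfold k, kap.
      replace ((F z - F a) * (z / (z - a)))%C with ((z * F z - z * F a) / (z - a))%C by (field; auto).
      rewrite Cmod_div by auto.
      pose proof (Cmod_triangle_rev a z) as T. rewrite Cmod_minus_sym in T. fold m in T. rewrite Hz in T.
      apply Rle_div_l. lra.
      apply Rle_trans with (2 * eta).
      + unfold Cminus. eapply Rle_trans. apply Cmod_triangle. rewrite Cmod_opp, (Cmod_mult z (F a)), Hz.
        specialize (HFd z (cexp_neq_0 _)). rewrite Hz in HFd. specialize (HFd ltac:(lra)). nra.
      + replace (2 * eta) with (eps / (2 * PI) * (m / 2)) by (unfold eta; field; lra).
        apply Rmult_le_compat_l. apply Rlt_le, Rdiv_lt_0_compat; lra. lra. }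
  assert (Hrk : forall y, rcont (fun t => k (cexp (x2, t))) y).
  { intros y. apply rcont_circle. apply Hk; trivial. apply cexp_neq_0. rewrite Hc2; lra. }
  assert (Hrkap : forall y, rcont (fun t => kap (cexp (x2, t))) y).
  { intros y. apply rcont_circle. apply Hkap; trivial. }
  (* Since [k] integrates to 0, [F a] comes out of the integral; bounding [F kap] above and [kap]
     below then isolates [|F a|]. *)
  assert (HB2 : circle_int (fun z => F z * kap z)%C x2 y0 = (F a * circle_int kap x2 y0)%C).
  { transitivity (circle_int (fun z => k z + F a * kap z)%C x2 y0).
    - apply CInt_ext. lra. intros. unfold k. ring.
    - unfold circle_int in *. rewrite CInt_plus, CInt_scal, HA; trivial; try lra. ring.
      intros y _. apply (rcont_circle (fun z => F a * kap z)%C).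
      destruct (Hkap (cexp (x2, y)) (Hne2 y)) as [l Hl].
      eexists. exact (cdiff_scal _ _ _ _ Hl). }
  assert (U : Cmod (circle_int (fun z => F z * kap z)%C x2 y0) <= (y0 + PI - (y0 - PI)) * (M * (rho / (rho - m)))).
  { apply CInt_bound. lra.
    - intros y _. apply (rcont_circle (fun z => F z * kap z)%C).
      destruct (Hkap (cexp (x2, y)) (Hne2 y)) as [l Hl].
      destruct (HF (cexp (x2, y))) as [l' Hl']. apply cexp_neq_0. rewrite Hc2; lra.
      eexists. exact (cdiff_mult _ _ _ _ _ Hl' Hl).
    - intros y _. rewrite Cmod_mult. apply Rmult_le_compat; try apply Cmod_ge_0. apply HM, Hc2.
      unfold kap. rewrite Cmod_div, Hc2 by auto. apply Rmult_le_compat_l. lra.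
      apply Rinv_le_contravar. lra. pose proof (Cmod_triangle_rev (cexp (x2, y)) a) as T.
      rewrite Hc2 in T. fold m in T. lra. }
  assert (V : (y0 + PI - (y0 - PI)) * (1 / 2) <= Cmod (circle_int kap x2 y0)).
  { eapply Rle_trans; [|eapply Rle_trans; [apply Rle_abs | apply re_le_Cmod]].
    apply CInt_Re_ge; try lra. auto. intros y _. apply Re_cauchy_kernel. rewrite Hc2. exact Har. }
  rewrite HB2, Cmod_mult in U.
  apply Rmult_le_reg_l with PI. exact Hpi.
  pose proof (Cmod_ge_0 (F a)).
  assert (Cmod (F a) * PI <= Cmod (F a) * Cmod (circle_int kap x2 y0)) by (apply Rmult_le_compat_l; lra).
  lra.
Qed.

(* The constant in [cauchy_estimate] is removed by applying it to the powers of [F]. *)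
Lemma punctured_maximum_principle (F : C -> C) (rho M : R) (a : C) :
  (forall z : C, z <> 0%C -> Cmod z < 1 -> exists l, cdiff F z l) ->
  (forall eps, 0 < eps -> exists d, 0 < d /\
     forall z : C, z <> 0%C -> Cmod z < d -> Cmod (z * F z) <= eps) ->
  0 < rho < 1 -> (forall z, Cmod z = rho -> Cmod (F z) <= M) ->
  a <> 0%C -> Cmod a < rho ->
  Cmod (F a) <= M.
Proof.
  intros HF HF0 Hrho HM Ha Har.
  assert (HM0 : 0 <= M).
  { eapply Rle_trans. apply Cmod_ge_0. apply (HM (RtoC rho)). rewrite Cmod_R, Rabs_pos_eq; lra. }
  (* The estimate for [F] itself already bounds [F] near 0. This is what lets [z F(z)^n -> 0] hold
     for every [n], so that the powers satisfy the hypotheses as well. *)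
  assert (Hbd : forall z : C, z <> 0%C -> Cmod z < rho / 2 -> Cmod (F z) <= 4 * M).
  { intros z Hz Hz2. eapply Rle_trans. apply (cauchy_estimate F rho M z); trivial. lra.
    assert (rho / (rho - Cmod z) <= 2) by (apply Rle_div_l; lra).
    assert (M * (rho / (rho - Cmod z)) <= M * 2) by (apply Rmult_le_compat_l; lra). lra. }
  assert (Hpow : forall n, Cmod (F a) ^ n <= 2 * (M ^ n * (rho / (rho - Cmod a)))).
  { intros n. rewrite <- Cmod_pow. apply (cauchy_estimate (fun z => F z ^ n)%C); trivial.
    - intros z Hz Hz1. destruct (HF z Hz Hz1) as [l Hl]. exact (cdiff_pow F z l n Hl).
    - intros eps He.
      assert (HB : 0 < (4 * M) ^ n + 1) by (pose proof (pow_le (4 * M) n ltac:(lra)); lra).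
      exists (Rmin (rho / 2) (eps / ((4 * M) ^ n + 1))).
      split. { apply Rmin_glb_lt. lra. apply Rdiv_lt_0_compat; assumption. }
      intros z Hz Hzd.
      assert (Z1 := Rlt_le_trans _ _ _ Hzd (Rmin_l _ _)). assert (Z2 := Rlt_le_trans _ _ _ Hzd (Rmin_r _ _)).
      apply Rlt_div_r in Z2; [|exact HB].
      rewrite Cmod_mult, Cmod_pow.
      assert (Cmod (F z) ^ n <= (4 * M) ^ n) by (apply pow_incr; split; [apply Cmod_ge_0 | auto]).
      pose proof (Cmod_ge_0 z). nra.
    - intros z Hz. rewrite Cmod_pow. apply pow_incr. split. apply Cmod_ge_0. auto. }
  apply Rnot_lt_le. intros Hlt.
  set (A := Cmod (F a)) in *. set (c := rho / (rho - Cmod a)) in *.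
  destruct (Req_dec M 0) as [E|E].
  { specialize (Hpow 1%nat). rewrite E in *. simpl in Hpow. lra. }
  assert (Hq : 1 < A / M) by (apply Rlt_div_r; lra).
  (* [Hpow] bounds [(A / M)^n] by [2 c] for all [n], while a ratio above 1 has unbounded powers. *)
  destruct (Pow_x_infinity (A / M)) with (b := 2 * c + 1) as [n Hn].
  { rewrite Rabs_pos_eq; lra. }
  specialize (Hn n (Nat.le_refl n)). specialize (Hpow n).
  rewrite Rabs_pos_eq in Hn by (apply pow_le; lra).
  assert (Hmn : 0 < M ^ n) by (apply pow_lt; lra).
  unfold Rdiv in Hn. rewrite Rpow_mult_distr, pow_inv in Hn.
  apply Rge_le, (Rle_div_r _ _ _ Hmn) in Hn. nra.
Qed.

(** * The bound on g and the square root *)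

Lemma continuous_max_on_circle (g : C -> C) (z : C) :
  z <> 0%C -> (forall w, Cmod w = Cmod z -> ccont g w) ->
  exists z0, Cmod z0 = Cmod z /\ forall w, Cmod w = Cmod z -> Cmod (g w) <= Cmod (g z0).
Proof.
  intros Hz Hg. pose proof PI_RGT_0.
  destruct (polar_form z Hz) as (x & y & _ & ->). rewrite Cmod_cexp in *. simpl Re in *.
  assert (Hc : forall t, Cmod (cexp (x, t)) = exp x) by (intros; apply Cmod_cexp).
  destruct (continuity_ab_maj (fun t => Cmod (g (cexp (x, t)))) (- PI) PI) as (t0 & Ht0 & _).
  - lra.
  - intros t _ eps He.
    assert (H1 : rcont (fun t => g (cexp (x, t))) t).
    { apply (ccont_rcont_v (fun w => g (cexp w))). apply ccont_comp.
      exact (cdiff_ccont _ _ _ (cdiff_cexp _)). apply Hg, Hc. }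
    destruct (proj1 (rcont_eps _ _) H1 eps He) as (d & Hd & H').
    assert (H2 : forall s, Rabs (s - t) < d -> Rabs (Cmod (g (cexp (x, s))) - Cmod (g (cexp (x, t)))) < eps).
    { intros s Hs. specialize (H' s Hs).
      pose proof (Cmod_triangle_rev (g (cexp (x, s))) (g (cexp (x, t)))).
      pose proof (Cmod_triangle_rev (g (cexp (x, t))) (g (cexp (x, s)))) as H2.
      rewrite Cmod_minus_sym in H2. apply Rabs_def1; lra. }
    exists d. split. exact Hd. intros s [_ Hs]. exact (H2 s Hs).
  - exists (cexp (x, t0)). split. apply Hc. intros w Hw.
    assert (Hw0 : w <> 0%C) by (apply Cmod_gt_0; rewrite Hw; apply exp_pos).
    destruct (polar_form w Hw0) as (x' & y' & Hy' & ->). rewrite Cmod_cexp in Hw. simpl Re in Hw.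
    apply exp_inv in Hw. subst x'. apply Ht0. exact Hy'.
Qed.

Lemma Cmod_scal_pos (s : R) (z : C) : 0 <= s -> Cmod (s * z) = s * Cmod z.
Proof. intros Hs. rewrite Cmod_mult, Cmod_R, Rabs_pos_eq by exact Hs. reflexivity. Qed.

(** The maximum principle is applied to [F z = g z / z^2]. Its condition at 0 reads [g z / z -> 0],
    which is exactly [g 0 = 0] together with the zero derivative there. *)
Lemma schwarz_second_order (g : C -> C) (M : R) (z0 : C) (s : R) :
  (forall z, Cmod z < 1 -> exists l, cdiff g z l) -> g 0%C = 0%C -> cdiff g 0 0 ->
  z0 <> 0%C -> Cmod z0 < 1 -> (forall w, Cmod w = Cmod z0 -> Cmod (g w) <= M) ->
  0 < s < 1 -> Cmod (g (s * z0)%C) <= s ^ 2 * M.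
Proof.
  intros Hg Hg0 Hg0' Hz0 Hz1 HM Hs.
  assert (Hr : 0 < Cmod z0) by (apply Cmod_gt_0; exact Hz0). set (rho := Cmod z0) in *.
  set (a := (s * z0)%C).
  assert (Hma : Cmod a = s * rho) by (apply Cmod_scal_pos; lra).
  assert (Ha : a <> 0%C) by (apply Cmod_gt_0; rewrite Hma; nra).
  assert (H : Cmod (g a / (a * a)) <= M / (rho * rho)).
  { apply (punctured_maximum_principle (fun z => g z / (z * z))%C rho (M / (rho * rho)) a); trivial; try nra.
    - intros z Hz Hzl. destruct (Hg z Hzl) as [l Hl]. eexists.
      apply (cdiff_mult g (fun z => / (z * z))%C). exact Hl.
      apply (cdiff_inv (fun z => z * z)%C). apply Cmult_neq_0; exact Hz.
      exact (cdiff_mult _ _ _ _ _ (cdiff_id z) (cdiff_id z)).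
    - intros eps He.
      destruct (proj1 (cderiv_eps _ _ _) (proj2 (cderiv_cdiff _ _ _) Hg0') eps He) as (d & Hd & H).
      exists d. split. exact Hd. intros z Hz Hzd. specialize (H z). rewrite Hg0 in H.
      replace (z - 0)%C with z in H by ring. specialize (H Hzd).
      replace (g z - 0 - 0 * z)%C with (g z) in H by ring.
      replace (z * (g z / (z * z)))%C with (g z / z)%C by (field; exact Hz).
      rewrite Cmod_div by exact Hz. apply Rle_div_l. apply Cmod_gt_0. exact Hz. exact H.
    - intros z Hz. assert (Hz' : z <> 0%C) by (apply Cmod_gt_0; lra).
      rewrite Cmod_div, Cmod_mult, Hz by (apply Cmult_neq_0; exact Hz').
      apply Rmult_le_compat_r. apply Rlt_le, Rinv_0_lt_compat. nra. auto. }
  rewrite Cmod_div, Cmod_mult, Hma in H by (apply Cmult_neq_0; exact Ha).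
  apply (Rle_div_l (Cmod (g a))) in H; [|apply Rmult_lt_0_compat; nra].
  replace (s ^ 2 * M) with (M / (rho * rho) * (s * rho * (s * rho))). exact H. field. lra.
Qed.

(* The growth [|g (s z0)| <= s^2 |g z0|] forces the radial derivative at a maximum point
   to be at least twice the value (a case of Jack's lemma). *)
Lemma jack_second_order (g : C -> C) (z0 l : C) :
  (forall z, Cmod z < 1 -> exists l, cdiff g z l) -> g 0%C = 0%C -> cdiff g 0 0 ->
  z0 <> 0%C -> Cmod z0 < 1 -> (forall w, Cmod w = Cmod z0 -> Cmod (g w) <= Cmod (g z0)) ->
  cdiff g z0 l -> Cmod (g z0) <= Cmod (g z0 - z0 * l).
Proof.
  intros Hg Hg0 Hg0' Hz0 Hz1 HM Hl.
  set (M := Cmod (g z0)) in *. assert (HM0 : 0 <= M) by apply Cmod_ge_0.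
  assert (Hr : 0 < Cmod z0) by (apply Cmod_gt_0; exact Hz0).
  apply le_epsilon. intros eps He.
  destruct (proj1 (cderiv_eps _ _ _) (proj2 (cderiv_cdiff _ _ _) Hl) (eps / 2)) as (d & Hd & H). lra.
  (* Here [s = 1 - t]. The second bound keeps [s z0] within [d] of [z0], since [|z0| < 1]; the third
     makes the quadratic leftover [t^2 M] at most [t eps / 2]. *)
  set (t := Rmin (1 / 2) (Rmin (d / 2) (eps / (2 * (M + 1))))).
  assert (Ht : 0 < t /\ t <= 1 / 2 /\ t <= d / 2 /\ t <= eps / (2 * (M + 1))).
  { assert (0 < eps / (2 * (M + 1))) by (apply Rdiv_lt_0_compat; lra).
    unfold t, Rmin. repeat destruct Rle_dec; lra. }
  clearbody t. destruct Ht as (T0 & T1 & T2 & T3). apply Rle_div_r in T3; [|lra].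
  set (D := (z0 * l)%C).
  pose proof (schwarz_second_order g M z0 (1 - t) Hg Hg0 Hg0' Hz0 Hz1 HM ltac:(lra)) as HS.
  specialize (H ((1 - t)%R * z0)%C).
  replace ((1 - t)%R * z0 - z0)%C with (- (t * z0))%C in H by (rewrite RtoC_minus; ring).
  rewrite Cmod_opp, Cmod_scal_pos in H by lra. specialize (H ltac:(nra)).
  replace (g ((1 - t)%R * z0) - g z0 - l * - (t * z0))%C
    with (g ((1 - t)%R * z0) - (g z0 - t * D))%C in H by (unfold D; ring).
  pose proof (Cmod_triangle_rev (g z0 - t * D) (g ((1 - t)%R * z0)%C)) as H1.
  rewrite (Cmod_minus_sym (g z0 - t * D) (g _)) in H1.
  (* Regrouping [g z0 - t D] as [(1 - t) g z0 - t (D - g z0)] brings in [X = |g z0 - D|]. Against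
     [(1 - t)^2 M] the terms of order 0 cancel, and dividing by [t] leaves [M <= X + eps]. *)
  pose proof (Cmod_triangle_rev ((1 - t)%R * g z0) (t * (D - g z0))) as H2.
  replace ((1 - t)%R * g z0 - t * (D - g z0))%C with (g z0 - t * D)%C in H2 by (rewrite RtoC_minus; ring).
  rewrite !Cmod_scal_pos, (Cmod_minus_sym D) in H2 by lra. fold M in H2.
  apply Rmult_le_reg_l with t. exact T0.
  set (X := Cmod (g z0 - D)) in *. set (Y := Cmod (g ((1 - t)%R * z0)%C)) in *.
  assert (t * (eps / 2) * Cmod z0 <= t * (eps / 2) * 1).
  { apply Rmult_le_compat_l; [apply Rmult_le_pos|]; lra. }
  assert (t * (t * M) <= t * (eps / 2)) by (apply Rmult_le_compat_l; nra).
  lra.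
Qed.

(** Each value is compared with the maximum over its own circle, where the previous lemma applies;
    strictness survives because the operator is evaluated at one single point. *)
Lemma bound_of_first_order_operator (g gp : C -> C) (lam : R) :
  (forall z, inD z -> cdiff g z (gp z)) -> g 0%C = 0%C -> gp 0%C = 0%C ->
  (forall z, inD z -> Cmod (g z - z * gp z) < lam) ->
  forall z, inD z -> Cmod (g z) < lam.
Proof.
  intros Hg Hg0 Hgp0 HU z Hz. unfold inD in *.
  assert (H0 : Cmod 0 < 1) by (rewrite Cmod_0; lra).
  destruct (Ceq_dec z 0) as [->|Hn].
  - specialize (HU 0%C H0). replace (g 0%C - 0 * gp 0%C)%C with (g 0%C) in HU by ring. exact HU.
  - destruct (continuous_max_on_circle g z Hn) as (z0 & Ez0 & HM).
    { intros w Hw. apply (cdiff_ccont _ _ (gp w)), Hg. lra. }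
    assert (Hz0 : z0 <> 0%C) by (apply Cmod_gt_0; rewrite Ez0; apply Cmod_gt_0; exact Hn).
    eapply Rle_lt_trans. apply HM. reflexivity.
    eapply Rle_lt_trans. 2: apply (HU z0); lra.
    apply jack_second_order; trivial; try lra.
    + intros w Hw. exists (gp w). auto.
    + rewrite <- Hgp0 at 2. auto.
    + rewrite Ez0. exact HM.
    + apply Hg. lra.
Qed.

(** * Mean value inequality and the expansion of f at the origin *)

Lemma derivable_pt_lim_Re_ray (h : C -> C) (z l : C) (t : R) :
  cdiff h (t * z) l -> derivable_pt_lim (fun s => Re (h (s * z)%C)) t (Re (l * z)).
Proof.
  intros Hl eps He.
  assert (HA : 0 < Cmod z + 1) by (pose proof (Cmod_ge_0 z); lra).
  destruct (proj1 (cderiv_eps _ _ _) (proj2 (cderiv_cdiff _ _ _) Hl) (eps / (2 * (Cmod z + 1)))) as (d & Hd & H).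
  { apply Rdiv_lt_0_compat; lra. }
  assert (Hd' : 0 < d / (Cmod z + 1)) by (apply Rdiv_lt_0_compat; lra).
  exists (mkposreal _ Hd'). intros k Hk Hkd. simpl in Hkd. apply Rlt_div_r in Hkd; [|exact HA].
  specialize (H ((t + k)%R * z)%C).
  replace ((t + k)%R * z - t * z)%C with (k * z)%C in H by (rewrite RtoC_plus; ring).
  rewrite Cmod_mult, Cmod_R in H.
  pose proof (Rabs_pos_lt k Hk) as Hk0. pose proof (Cmod_ge_0 z) as Hz0.
  specialize (H ltac:(nra)).
  replace ((Re (h ((t + k)%R * z)%C) - Re (h (t * z)%C)) / k - Re (l * z))
    with (Re (h ((t + k)%R * z) - h (t * z) - l * (k * z))%C / k).
  2: { destruct (h ((t + k)%R * z)%C), (h (t * z)%C), l, z. simpl. field. exact Hk. }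
  unfold Rdiv at 1. rewrite Rabs_mult, Rabs_inv. apply Rlt_div_l. exact Hk0.
  eapply Rle_lt_trans. apply re_le_Cmod. eapply Rle_lt_trans. exact H.
  replace (eps / (2 * (Cmod z + 1)) * (Rabs k * Cmod z)) with (eps * Rabs k * (Cmod z / (2 * (Cmod z + 1)))) by (field; lra).
  assert (Cmod z / (2 * (Cmod z + 1)) < 1) by (apply Rlt_div_l; lra).
  assert (0 < eps * Rabs k) by nra. nra.
Qed.

(** The real mean value theorem is applied to [t -> Re (u h(t z))] with [u] the conjugate of [h z],
    which makes the value at [t = 1] equal to [|h z|^2]; one factor [|h z|] is then cancelled. *)
Lemma mean_value_bound (h hp : C -> C) (z : C) (B : R) :
  (forall w, Cmod w <= Cmod z -> cdiff h w (hp w) /\ Cmod (hp w) <= B) -> h 0%C = 0%C ->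
  Cmod (h z) <= B * Cmod z.
Proof.
  intros H H0. set (u := Cconj (h z)).
  assert (Hray : forall t : R, 0 <= t <= 1 -> Cmod (t * z) <= Cmod z).
  { intros t Ht. rewrite Cmod_scal_pos by lra. pose proof (Cmod_ge_0 z). nra. }
  destruct (MVT_cor2 (fun t : R => Re (u * h (t * z))%C) (fun t : R => Re (u * hp (t * z) * z)%C) 0 1)
    as (t & E & Ht). lra.
  { intros t Ht. apply (derivable_pt_lim_Re_ray (fun w => u * h w)%C). apply cdiff_scal. apply H. auto. }
  rewrite Cmult_1_l, Cmult_0_l, H0, Cmult_0_r in E.
  assert (E1 : Re (u * h z) = Cmod (h z) ^ 2).
  { unfold u. rewrite Cmult_comm, <- re_RtoC, Cmod2_conj. reflexivity. }
  rewrite E1 in E. change (Re 0) with 0 in E.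
  assert (E2 : Cmod (h z) ^ 2 <= Cmod (h z) * (B * Cmod z)).
  { replace (Cmod (h z) ^ 2) with (Re (u * hp (t * z) * z)%C) by lra.
    eapply Rle_trans. apply Rle_abs. eapply Rle_trans. apply re_le_Cmod.
    rewrite 2!Cmod_mult. unfold u. rewrite Cmod_conj, Rmult_assoc.
    apply Rmult_le_compat_l. apply Cmod_ge_0. apply Rmult_le_compat_r. apply Cmod_ge_0.
    apply H, Hray. lra. }
  pose proof (Cmod_ge_0 (h z)) as P. destruct (Req_dec (Cmod (h z)) 0) as [E3|E3].
  - rewrite E3. apply Rmult_le_pos. 2: apply Cmod_ge_0.
    eapply Rle_trans. 2: apply (H z); lra. apply Cmod_ge_0.
  - apply Rmult_le_reg_l with (Cmod (h z)). lra. simpl in E2. lra.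
Qed.

(** The function [f w - w - a2 w^2] vanishes at 0 and has derivative [fp w - 1 - 2 a2 w], at most
    [eps |z|] on [|w| <= |z|] by differentiability of [fp] at 0. The mean value inequality gives
    [eps |z|^2], and dividing by [z] gives the claim. *)
Lemma cdiff_quotient_at_0 (f fp : C -> C) (a2 : C) :
  (forall z, inD z -> cdiff f z (fp z)) -> f 0%C = 0%C -> fp 0%C = 1%C -> cdiff fp 0 (2 * a2) ->
  cdiff (fun z => if Ceq_dec z 0 then 1%C else f z / z)%C 0 a2.
Proof.
  intros Hf Hf0 Hfp0 Hfp. apply cderiv_cdiff, cderiv_eps. intros eps He.
  destruct (proj1 (cderiv_eps _ _ _) (proj2 (cderiv_cdiff _ _ _) Hfp) eps He) as (d & Hd & H).
  exists (Rmin d 1). split. { apply Rmin_glb_lt; lra. }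
  intros z Hz. replace (z - 0)%C with z in * by ring.
  assert (Z1 := Rlt_le_trans _ _ _ Hz (Rmin_l _ _)). assert (Z2 := Rlt_le_trans _ _ _ Hz (Rmin_r _ _)).
  destruct (Ceq_dec 0 0) as [_|]; [|congruence].
  destruct (Ceq_dec z 0) as [->|Hn].
  { replace (1 - 1 - a2 * 0)%C with (RtoC 0) by ring. rewrite Cmod_0. lra. }
  assert (B : Cmod (f z + - (1) * z + - a2 * (z * z))%C <= eps * Cmod z * Cmod z).
  { apply (mean_value_bound (fun w => f w + - (1) * w + - a2 * (w * w))%C (fun w => fp w - 1 - 2 * a2 * w)%C).
    - intros w Hw. split.
      + eapply cdiff_eq.
        exact (cdiff_plus _ _ _ _ _ (cdiff_plus _ _ _ _ _ (Hf w ltac:(unfold inD; lra)) (cdiff_scal _ (- (1)) _ _ (cdiff_id w)))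
          (cdiff_scal _ (- a2) _ _ (cdiff_mult _ _ _ _ _ (cdiff_id w) (cdiff_id w)))).
        cbv beta; ring.
      + specialize (H w). rewrite Hfp0 in H. replace (w - 0)%C with w in H by ring.
        eapply Rle_trans. apply H. lra. apply Rmult_le_compat_l; lra.
    - rewrite Hf0. ring. }
  replace (f z / z - 1 - a2 * z)%C with ((f z + - (1) * z + - a2 * (z * z)) / z)%C by (field; exact Hn).
  rewrite Cmod_div by exact Hn. apply Rle_div_l. apply Cmod_gt_0; exact Hn. exact B.
Qed.

(** * The principal square root *)

Lemma principal_sqrt_exists (w : C) : exists s : C, (s * s)%C = w /\ 0 <= Re s.
Proof.
  destruct (Ceq_dec w 0) as [->|Hw].
  - exists 0%C. split. ring. simpl. lra.
  - destruct (polar_form w Hw) as (x & y & Hy & ->). exists (cexp (x / 2, y / 2)). split.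
    + rewrite <- cexp_plus. f_equal. apply injective_projections; simpl; field.
    + unfold cexp. simpl. apply Rmult_le_pos. left; apply exp_pos. apply cos_ge_0; lra.
Qed.

(** The slope of [S] is [1 / (S w + S w0)], whose denominator has real part at least
    [Re (S w0) > 0]; continuity and differentiability both follow. On the negative real axis [S] may
    take either sign, but [w0] is kept off it. *)
Lemma cdiff_principal_sqrt (S : C -> C) (w0 : C) :
  (forall w, (S w * S w)%C = w /\ 0 <= Re (S w)) -> 0 < Re (S w0) -> exists l, cdiff S w0 l.
Proof.
  intros HS H0.
  assert (Hlb : forall w, Re (S w0) <= Cmod (S w + S w0)).
  { intros w. eapply Rle_trans; [|apply re_le_Cmod]. eapply Rle_trans; [|apply Rle_abs].
    destruct (HS w) as [_ H]. change (Re (S w + S w0)%C) with (Re (S w) + Re (S w0)). lra. }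
  assert (Hn : forall w, (S w + S w0)%C <> 0%C).
  { intros w. apply Cmod_gt_0. specialize (Hlb w). lra. }
  assert (E : forall w, (S w = S w0 + / (S w + S w0) * (w - w0))%C).
  { intros w. replace (w - w0)%C with (S w * S w - S w0 * S w0)%C
      by (rewrite (proj1 (HS w)), (proj1 (HS w0)); reflexivity).
    field. apply Hn. }
  assert (Hc : ccont S w0).
  { intros eps He. exists (eps * Re (S w0)). split. nra.
    intros w Hw. rewrite (E w). replace (S w0 + / (S w + S w0) * (w - w0) - S w0)%C with ((w - w0) / (S w + S w0))%C by (field; apply Hn).
    rewrite Cmod_div by apply Hn. specialize (Hlb w). apply Rlt_div_l. lra. nra. }
  eexists. exists (fun w => / (S w + S w0))%C. split. reflexivity. split.
  - apply (ccont_inv (fun w => S w + S w0)%C). apply Hn. apply ccont_plus. exact Hc. apply ccont_const.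
  - exists 1. split. lra. intros w _. apply E.
Qed.

Open Scope C_scope.

(* f ∈ U(λ): f analytic in D with derivative f' (= fp), f(0)=0, f'(0)=1,
   f(z) ≠ 0 on D∖{0}, and |(z/f(z))^2 f'(z) - 1| < λ on D (at z=0 the
   expression equals 0 via the removable singularity).  a2 = f''(0)/2. *)
Theorem theorem3p1 (lam : R) (f fp : C -> C) (a2 : C) :
  (0 < lam <= 1)%R ->
  (forall z, inD z -> cderiv f z (fp z)) ->
  f 0 = 0 -> fp 0 = 1 ->
  (forall z, inD z -> z <> 0 -> f z <> 0) ->
  (forall z, inD z -> (Cmod ((z_over_f f z) ^ 2 * fp z - 1) < lam)%R) ->
  cderiv fp 0 (2 * a2) ->
  subordinate (fun z => z_over_f f z + a2 * z)
              (fun z => 1 + 2 * RtoC lam * z + RtoC lam * z ^ 2).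
Proof.
  intros Hlam Hf0 Ef Efp Hnz HU Hfp0.
  assert (Hf : forall z, inD z -> cdiff f z (fp z)) by (intros z Hz; apply cderiv_cdiff; auto).
  assert (Hlam0 : RtoC lam <> 0) by (intros E; apply RtoC_inj in E; lra).
  set (g := fun z => z_over_f f z + a2 * z - 1).
  set (gp := fun z => if Ceq_dec z 0 then RtoC 0 else (f z - z * fp z) / (f z * f z) + a2).
  assert (Hg : forall z, inD z -> cdiff g z (gp z)).
  { intros z Hz. unfold gp. destruct (Ceq_dec z 0) as [->|Hn].
    (* At 0, [z / f z] is treated as the reciprocal of the completed quotient [f z / z], which has
       value 1 and derivative [a2]; its derivative [-a2] is cancelled by that of [a2 z]. *)
    - apply cdiff_local with (f := fun z => / (if Ceq_dec z 0 then 1 else f z / z) + a2 * z + - (1)) (d := 1%R). lra.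
      + intros w Hw. replace (w - 0) with w in Hw by ring. unfold g, z_over_f.
        destruct (Ceq_dec w 0) as [_|Hw0]. field. pose proof (Hnz w Hw Hw0). field. auto.
      + pose proof (cdiff_quotient_at_0 f fp a2 Hf Ef Efp (proj1 (cderiv_cdiff _ _ _) Hfp0)) as HP.
        eapply cdiff_eq.
        refine (cdiff_plus _ _ _ _ _ (cdiff_plus _ _ _ _ _ (cdiff_inv _ _ _ _ HP) (cdiff_scal _ a2 _ _ (cdiff_id 0))) (cdiff_const (- (1)) 0)).
        all: cbv beta; destruct (Ceq_dec 0 0) as [_|]; [|congruence]. intros E; apply RtoC_inj in E; lra. field.
    - destruct (ccont_neq_0 (fun w => w) z Hn (ccont_id z)) as (d & Hd & Hd').
      apply cdiff_local with (f := fun w => w * / f w + a2 * w + - (1)) (d := d). exact Hd.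
      + intros w Hw. unfold g, z_over_f. destruct (Ceq_dec w 0) as [E|_]. exfalso. exact (Hd' w Hw E).
        unfold Cdiv. ring.
      + pose proof (Hnz z Hz Hn) as Hfz. eapply cdiff_eq.
        refine (cdiff_plus _ _ _ _ _ (cdiff_plus _ _ _ _ _ (cdiff_mult _ _ _ _ _ (cdiff_id z)
          (cdiff_inv _ _ _ Hfz (Hf z Hz))) (cdiff_scal _ a2 _ _ (cdiff_id z))) (cdiff_const (- (1)) z)).
        cbv beta. field. exact Hfz. }
  assert (Hg0 : g 0 = 0).
  { unfold g, z_over_f. destruct (Ceq_dec 0 0) as [_|]; [|congruence]. ring. }
  assert (Hgp0 : gp 0 = 0).
  { unfold gp. destruct (Ceq_dec 0 0) as [_|]; [|congruence]. reflexivity. }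
  assert (Hglam : forall z, inD z -> (Cmod (g z) < lam)%R).
  { apply (bound_of_first_order_operator g gp); trivial. intros z Hz. specialize (HU z Hz).
    replace (g z - z * gp z) with (z_over_f f z ^ 2 * fp z - 1). exact HU.
    unfold g, gp, z_over_f. destruct (Ceq_dec z 0) as [->|Hn]. rewrite Efp. simpl. ring.
    pose proof (Hnz z Hz Hn). simpl. field. auto. }
  destruct (constructive_indefinite_description (fun S : C -> C =>
    forall w, S w * S w = w /\ (0 <= Re (S w))%R)) as [S HS].
  { exists (fun w => proj1_sig (constructive_indefinite_description _ (principal_sqrt_exists w))).
    intros w. apply proj2_sig. }
  assert (Hzeta : forall z, inD z -> (Cmod (g z / lam) < 1)%R).
  { intros z Hz. rewrite Cmod_div, Cmod_R, Rabs_pos_eq by (lra || exact Hlam0).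
    specialize (Hglam z Hz). apply Rlt_div_l; lra. }
  assert (HRe : forall z, inD z -> (0 < Re (S (1 + g z / lam)%C))%R).
  { intros z Hz. specialize (Hzeta z Hz). destruct (HS (1 + g z / lam)) as [E P].
    pose proof (re_le_Cmod (g z / lam)) as Hre. pose proof (Rcomplements.Rabs_maj2 (Re (g z / lam))) as Hre2.
    apply (f_equal Re) in E. destruct (S (1 + g z / lam)) as [u v].
    change (u * u - v * v = 1 + Re (g z / lam))%R in E. simpl in P |- *.
    (* A purely imaginary root would have square [-v^2], whereas [1 + g z / lam] has positive real
       part. *)
    destruct (Req_dec u 0) as [Eu|]; [|lra]. rewrite Eu in E. nra. }
  exists (fun z => S (1 + g z / lam) - 1). repeat split.
  - intros z Hz. destruct (cdiff_principal_sqrt S (1 + g z / lam) HS (HRe z Hz)) as [l Hl].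
    eexists. apply cderiv_cdiff.
    refine (cdiff_plus _ _ _ _ _ (cdiff_comp S (fun z => 1 + g z / lam) z l _ Hl _) (cdiff_const (- (1)) z)).
    refine (cdiff_plus _ _ _ _ _ (cdiff_const 1 z) (cdiff_mult g _ _ _ _ (Hg z Hz) (cdiff_const (/ lam) z))).
  - assert (H0 : inD 0) by (unfold inD; rewrite Cmod_0; lra).
    specialize (HRe 0 H0). rewrite Hg0 in *.
    replace (1 + 0 / lam) with (RtoC 1) in * by (field; exact Hlam0).
    destruct (HS 1) as [E _].
    (* [S 1] is 1 or -1, and the positive real part excludes -1. *)
    assert (E2 : (S 1 - 1) * (S 1 + 1) = 0) by (replace ((S 1 - 1) * (S 1 + 1)) with (S 1 * S 1 - 1) by ring; rewrite E; ring).
    destruct (Ceq_dec (S 1 - 1) 0) as [|N]; trivial. exfalso. revert E2. apply Cmult_neq_0; trivial.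
    intros E3. apply (f_equal Re) in E3. change (Re (S 1) + 1 = 0)%R in E3. lra.
  - intros z Hz. unfold inD. specialize (HRe z Hz). specialize (Hzeta z Hz).
    destruct (HS (1 + g z / lam)) as [E _]. set (s := S (1 + g z / lam)) in *.
    replace (g z / lam) with ((s - 1) * (s + 1)) in Hzeta.
    2: { replace ((s - 1) * (s + 1)) with (s * s - 1) by ring. rewrite E. ring. }
    rewrite Cmod_mult in Hzeta.
    assert (1 <= Cmod (s + 1))%R.
    { eapply Rle_trans; [|apply re_le_Cmod]. eapply Rle_trans; [|apply Rle_abs]. change (1 <= Re s + 1)%R. lra. }
    pose proof (Cmod_ge_0 (s - 1)). nra.
  - intros z Hz. destruct (HS (1 + g z / lam)) as [E _]. set (s := S (1 + g z / lam)) in *.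
    replace (1 + 2 * lam * (s - 1) + lam * (s - 1) ^ 2) with (1 + lam * (s * s - 1)) by (simpl; ring).
    rewrite E. unfold g. field. exact Hlam0.
Qed.
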